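(* Let $n\geq 3$ and $k\geq 1$ be integers, let $K$ be a field, and let $R=K[V(T_{n,k})]$. Then $$\operatorname{depth}(R/I(T_{n,k}))=\operatorname{sdepth}(R/I(T_{n,k}))=\begin{cases}\dfrac{n(n-1)^{k+1}+n^{3}-4n^{2}+4n-2}{(n-1)^{3}-1}, & \text{if } k\equiv 0 \pmod 3;\\[2mm] \dfrac{n(n-1)^{k+1}-n^{2}+2n-2}{(n-1)^{3}-1}, & \text{if } k\equiv 1 \pmod 3;\\[2mm] \dfrac{n(n-1)^{k+1}-n}{(n-1)^{3}-1}, & \text{if } k\equiv 2 \pmod 3.\end{cases}$$
   Context: For a finite simple graph $G$, $K[V(G)]$ denotes the polynomial ring over $K$ whose variables are the vertices of $G$, and the edge ideal $I(G)\subset K[V(G)]$ is the ideal generated by the monomials $xy$ with $\{x,y\}$ an edge of $G$. Perfect semiregular tree $T_{n,k}$: the rooted tree in which all non-pendant vertices (vertices of degree $\neq 1$) have degree $n$ and all pendant vertices (leaves) are at distance $k$ from the root. Explicitly, the root has $n$ children, every other non-leaf vertex has exactly $n-1$ children, and all leaves are at distance $k$ from the root. Depth: for a finitely generated graded module $M$ over a polynomial ring $S=K[x_1,\dots,x_N]$, $\operatorname{depth}(M)$ is the common length of all maximal $M$-sequences in $\mathfrak m=(x_1,\dots,x_N)$. Stanley depth: let $M$ be a finitely generated $\mathbb{Z}^N$-graded $S$-module. For a homogeneous element $u\in M$ and $Z\subseteq\{x_1,\dots,x_N\}$, let $uK[Z]$ be the $K$-subspace of $M$ generated by all $uy$ with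 $y$ a monomial in $K[Z]$; if $uK[Z]$ is a free $K[Z]$-module, it is called a Stanley space of dimension $|Z|$. A Stanley decomposition $\mathcal D$ of $M$ is a decomposition of the $K$-vector space $M$ as a finite direct sum of Stanley spaces $M=\bigoplus_{j=1}^r u_jK[Z_j]$; put $\operatorname{sdepth}(\mathcal D)=\min\{|Z_j|: j=1,\dots,r\}$, and $\operatorname{sdepth}(M)=\max\{\operatorname{sdepth}(\mathcal D): \mathcal D \text{ is a Stanley decomposition of } M\}$. *)

(* Defs.v *)
From HB Require Import structures.
From mathcomp Require Import all_boot all_order all_algebra.
From mathcomp Require Import generic_quotient ring_quotient.
From mathcomp Require Import boolp.
From mathcomp Require Import mpoly.

Set Implicit Arguments.
Unset Strict Implicit.
Unset Printing Implicit Defensive.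

Import GRing.Theory.
Local Open Scope ring_scope.
Local Open Scope quotient_scope.

Section QuotientModule.
Variables (R : comNzRingType) (I : idealr R).
Local Notation Q := {ideal_quot I}.

Definition quot_scale (a : R) (x : Q) : Q := \pi_Q a * x.

Fact quot_scaleA a b x : quot_scale a (quot_scale b x) = quot_scale (a * b) x.
Proof. by rewrite /quot_scale mulrA -rmorphM. Qed.
Fact quot_scale1 : left_id 1 quot_scale.
Proof. by move=> x; rewrite /quot_scale rmorph1 mul1r. Qed.
Fact quot_scaleDr : right_distributive quot_scale +%R.
Proof. by move=> a x y; rewrite /quot_scale mulrDr. Qed.
Fact quot_scaleDl x : {morph quot_scale^~ x : a b / a + b}.
Proof. by move=> a b; rewrite /quot_scale rmorphD mulrDl. Qed.

HB.instance Definition _ := GRing.Zmodule_isLmodule.Build R Q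
  quot_scaleA quot_scale1 quot_scaleDr quot_scaleDl.

Lemma quot_scaleE a p : a *: \pi_Q p = \pi_Q (a * p) :> Q.
Proof. by rewrite rmorphM. Qed.

Lemma quot_eq0 p : (\pi_Q p == 0) = (p \in I).
Proof. by rewrite -(rmorph0 \pi_Q) -Quotient.idealrBE subr0. Qed.
End QuotientModule.

Definition ideal_generated (R : nzRingType) (A : R -> Prop) (p : R) : Prop :=
  exists2 s : seq (R * R),
    (forall ag, ag \in s -> A ag.2) & p = \sum_(ag <- s) ag.1 * ag.2.

Section Depth.
Variables (K : fieldType) (N : nat).
Local Notation S := {mpoly K[N]}.

Definition maxideal : S -> Prop := ideal_generated (fun p => exists i, p = 'X_i).

Section Module.
Variable M : lmodType S.

(* [x] lies in the submodule (f_1, ..., f_r) M. *)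
Definition in_smul (fs : seq S) (x : M) : Prop :=
  exists z : nat -> M, x = \sum_(j < size fs) fs`_j *: z j.

(* Each f_(i+1) is a nonzerodivisor on M / (f_1, ..., f_i) M, and
   M / (f_1, ..., f_r) M is nonzero. *)
Definition regular_sequence (fs : seq S) : Prop :=
  (forall i, (i < size fs)%N -> forall x : M,
     in_smul (take i fs) (fs`_i *: x) -> in_smul (take i fs) x)
  /\ exists x : M, ~ in_smul fs x.

Definition regular_sequence_in_max (fs : seq S) : Prop :=
  regular_sequence fs /\ forall f, f \in fs -> maxideal f.

Definition maximal_regular_sequence (fs : seq S) : Prop :=
  regular_sequence_in_max fs
  /\ forall g, ~ regular_sequence_in_max (rcons fs g).

Definition is_depth (d : nat) : Prop :=
  (exists fs, maximal_regular_sequence fs)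
  /\ forall fs, maximal_regular_sequence fs -> size fs = d.
End Module.
End Depth.

Section Multigraded.
Variables (K : fieldType) (N : nat).
Local Notation S := {mpoly K[N]}.
Local Notation deg := {ffun 'I_N -> int}.

Definition mnm_deg (m : 'X_{1..N}) : deg := [ffun i => (m i)%:Z].

(* A Z^N-grading: [M] is the direct sum of the K-subspaces [hcomp a], and
   X^m maps [hcomp a] to [hcomp (a + m)].  The case m = 0 of [hcomp_scale] is
   stability under scalars of K. *)
Record multigrading (M : lmodType S) := Multigrading {
  hcomp :> deg -> M -> Prop;
  hcomp0 : forall a, hcomp a 0;
  hcompD : forall a x y, hcomp a x -> hcomp a y -> hcomp a (x + y);
  hcomp_scale : forall a x (c : K) (m : 'X_{1..N}),
    hcomp a x -> hcomp (a + mnm_deg m) ((c *: 'X_[m] : S) *: x);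
  hcomp_span : forall x, exists s : seq deg, exists y : deg -> M,
    (forall a, hcomp a (y a)) /\ x = \sum_(a <- s) y a;
  hcomp_indep : forall (s : seq deg) (y : deg -> M), uniq s ->
    (forall a, hcomp a (y a)) -> \sum_(a <- s) y a = 0 ->
    forall a, a \in s -> y a = 0 }.

Section Module.
Variables (M : lmodType S) (gM : multigrading M).

Definition homogeneous (u : M) : Prop := exists a, gM a u.

Definition in_subring (Z : {set 'I_N}) (p : S) : Prop :=
  forall m, m \in msupp p -> forall i, i \notin Z -> m i = 0%N.

Definition in_stanley_space (u : M) (Z : {set 'I_N}) (x : M) : Prop :=
  exists2 p : S, in_subring Z p & x = p *: u.

(* [u K[Z]] is a free K[Z]-module with basis [u]. *)
Definition is_stanley_space (u : M) (Z : {set 'I_N}) : Prop :=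
  homogeneous u /\ forall p : S, in_subring Z p -> p *: u = 0 -> p = 0.

Definition stanley_decomposition (r : nat)
    (u : 'I_r -> M) (Z : 'I_r -> {set 'I_N}) : Prop :=
  (forall j, is_stanley_space (u j) (Z j))
  /\ forall x : M, exists! w : {ffun 'I_r -> M},
       (forall j, in_stanley_space (u j) (Z j) (w j)) /\ x = \sum_j w j.

(* Since #|Z j| <= N, the default value N does not affect the minimum as soon
   as r > 0, which holds for every decomposition of a nonzero module. *)
Definition sdepth_decomposition (r : nat) (Z : 'I_r -> {set 'I_N}) : nat :=
  \big[minn/N]_(j < r) #|Z j|.

Definition is_sdepth (d : nat) : Prop :=
  (exists r (u : 'I_r -> M) (Z : 'I_r -> {set 'I_N}),
     stanley_decomposition u Z /\ sdepth_decomposition Z = d)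
  /\ forall r (u : 'I_r -> M) (Z : 'I_r -> {set 'I_N}),
     stanley_decomposition u Z -> (sdepth_decomposition Z <= d)%N.
End Module.

Section QuotientGrading.
Variable I : idealr S.
Hypothesis monI : forall p m, p \in (I : pred S) -> p@_m *: 'X_[m] \in (I : pred S).
Local Notation Q := {ideal_quot I}.

Definition deg_supported (a : deg) (p : S) : Prop :=
  forall m, m \in msupp p -> mnm_deg m = a.

Definition quot_hcomp (a : deg) (x : Q) : Prop :=
  exists2 p : S, deg_supported a p & x = \pi_Q p.

Lemma mnm_deg_inj : injective mnm_deg.
Proof.
by move=> m m' /ffunP e; apply/mnmP => i; have := e i; rewrite !ffunE => -[].
Qed.

Lemma deg_supported_coef a p m : deg_supported a p -> mnm_deg m != a -> p@_m = 0.
Proof.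
by move=> ap ma; apply/eqP; rewrite mcoeff_eq0; apply: contra ma => /ap ->.
Qed.

Fact quot_hcomp0 a : quot_hcomp a 0.
Proof. by exists 0; rewrite ?rmorph0 // => m; rewrite msupp0. Qed.

Fact quot_hcompD a x y : quot_hcomp a x -> quot_hcomp a y -> quot_hcomp a (x + y).
Proof.
move=> [p ap ->] [q aq ->]; exists (p + q); rewrite ?rmorphD // => m.
by move/msuppD_le; rewrite mem_cat => /orP[/ap|/aq].
Qed.

Fact quot_hcomp_scale a x (c : K) (m : 'X_{1..N}) :
  quot_hcomp a x -> quot_hcomp (a + mnm_deg m) ((c *: 'X_[m] : S) *: x).
Proof.
move=> [p ap ->]; exists (c *: 'X_[m] * p); rewrite ?quot_scaleE // => m'.
rewrite -scalerAl => /msuppZ_le; rewrite mulrC (perm_mem (msuppMX _ _)).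
case/mapP => m0 /ap <- ->; apply/ffunP => i.
by rewrite !ffunE mnmDE PoszD addrC.
Qed.

Fact quot_hcomp_span x : exists s : seq deg, exists y : deg -> Q,
  (forall a, quot_hcomp a (y a)) /\ x = \sum_(a <- s) y a.
Proof.
pose p := repr x.
exists (map mnm_deg (msupp p)).
exists (fun a => \sum_(m <- msupp p | mnm_deg m == a) \pi_Q (p@_m *: 'X_[m])).
split=> [a|].
  exists (\sum_(m <- msupp p | mnm_deg m == a) p@_m *: 'X_[m]); last by rewrite rmorph_sum.
  move=> m; rewrite mcoeff_msupp raddf_sum /= => h; apply/eqP; apply: contraR h => ma.
  rewrite big1_seq // => m' /andP[/eqP m'a _]; rewrite mcoeffZ mcoeffX.
  by case: eqP => [e|]; rewrite ?mulr0 // -e m'a eqxx in ma *.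
rewrite big_map -[x]reprK -/p {1}[p]mpolyE rmorph_sum /= big_seq [RHS]big_seq.
apply: eq_bigr => m mp; under eq_bigl => m' do rewrite (inj_eq mnm_deg_inj).
by rewrite -big_filter filter_pred1_uniq ?msupp_uniq ?big_seq1.
Qed.

Fact quot_hcomp_indep (s : seq deg) (y : deg -> Q) : uniq s ->
  (forall a, quot_hcomp a (y a)) -> \sum_(a <- s) y a = 0 ->
  forall a, a \in s -> y a = 0.
Proof.
move=> us hy; have /choice[p hp] : forall a, exists p : S,
  deg_supported a p /\ y a = \pi_Q p by move=> a; have [p] := hy a; exists p.
rewrite (eq_bigr (fun a => \pi_Q (p a))) => [|a _]; last by case: (hp a).
rewrite -rmorph_sum => /eqP; rewrite quot_eq0 => sI a sa.
have [ap ->] := hp a; apply/eqP; rewrite quot_eq0 [p a]mpolyE.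
rewrite big_seq; apply: rpred_sum => m mp.
suff -> : (p a)@_m = (\sum_(b <- s) p b)@_m by apply: monI.
rewrite raddf_sum /= (bigD1_seq a) //= big1 ?addr0 // => b ba.
by apply: (deg_supported_coef (hp b).1); rewrite (ap _ mp) eq_sym.
Qed.

Definition quot_grading : multigrading Q :=
  Multigrading quot_hcomp0 quot_hcompD quot_hcomp_scale
    quot_hcomp_span quot_hcomp_indep.
End QuotientGrading.
End Multigraded.

Record sgraph := SGraph {
  vertex :> finType;
  adj : rel vertex;
  adj_sym : ssrbool.symmetric adj;
  adj_irr : irreflexive adj }.

Section EdgeIdeal.
Variables (K : fieldType) (G : sgraph).

(* K[V(G)]; the variable attached to the vertex v is 'X_(enum_rank v). *)
Definition vpoly := {mpoly K[#|G|]}.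
Definition vvar (v : G) : vpoly := 'X_(enum_rank v).

Definition edge_ideal : {pred vpoly} := fun p =>
  `[< ideal_generated (fun q => exists v w : G, adj v w /\ q = vvar v * vvar w) p >].

Definition edge_mnm (v w : G) : 'X_{1..#|G|} :=
  (U_(enum_rank v) + U_(enum_rank w))%MM.

Lemma edge_mnmE v w : vvar v * vvar w = 'X_[edge_mnm v w].
Proof. by rewrite mpolyXD. Qed.

Lemma edge_ideal_msupp p m : p \in edge_ideal -> m \in msupp p ->
  exists v w : G, adj v w /\ (edge_mnm v w <= m)%MM.
Proof.
move=> /asboolP[s sA ->]; rewrite mcoeff_msupp raddf_sum /= => h.
apply: contrapT => hn; case/negP: h; rewrite big1_seq // => -[c g] /= gs.
have [v [w [vw /= ->]]] := sA _ gs; rewrite edge_mnmE.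
apply/eqP; rewrite mcoeff_eq0 (perm_mem (msuppMX _ _)).
apply/mapP => -[m' _ e]; apply: hn; exists v, w; split => //.
by rewrite e lem_addr.
Qed.

Fact edge_ideal_closed : idealr_closed edge_ideal.
Proof.
split.
- by apply/asboolP; exists [::]; rewrite ?big_nil.
- apply/negP => /(@edge_ideal_msupp _ 0%MM).
  rewrite msupp1 inE eqxx => /(_ isT)[v [w [_ /mnm_lepP/(_ (enum_rank v))]]].
  by rewrite mnmDE !mnmE eqxx.
- move=> a p q /asboolP[s sA ->] /asboolP[t tA ->]; apply/asboolP.
  exists ([seq (a * cg.1, cg.2) | cg <- s] ++ t) => [cg|].
    by rewrite mem_cat => /orP[/mapP[cg' /sA ? ->]|/tA].
  rewrite big_cat big_map /= mulr_sumr; congr (_ + _).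
  by apply: eq_bigr => cg _; rewrite mulrA.
Qed.

HB.instance Definition _ := isIdealr.Build vpoly edge_ideal edge_ideal_closed.

Definition edge_quotient := {ideal_quot edge_ideal}.
HB.instance Definition _ := GRing.Lmodule.on edge_quotient.

Lemma edge_ideal_monomial p m :
  p \in edge_ideal -> p@_m *: 'X_[m] \in edge_ideal.
Proof.
move=> pI; have [mp|/memN_msupp_eq0 ->] := boolP (m \in msupp p); last first.
  by rewrite scale0r rpred0.
have [v [w [vw le_m]]] := edge_ideal_msupp pI mp.
apply/asboolP; exists [:: (p@_m *: 'X_[m - edge_mnm v w], vvar v * vvar w)].
  by move=> cg; rewrite inE => /eqP->; exists v, w.
by rewrite big_seq1 /= edge_mnmE -scalerAl -mpolyXD submK.
Qed.

Definition edge_grading : multigrading edge_quotient :=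
  quot_grading edge_ideal_monomial.
End EdgeIdeal.

(* A vertex of T_{n,k} is the word of the child indices met on the path from
   the root (the empty word): the root has n children, every other vertex at
   distance < k from the root has n - 1. *)
Section PerfectSemiregularTree.
Variables n k : nat.

Definition tree_vertex : finType :=
  {w : k.-bseq 'I_n | all (fun i : 'I_n => i < n.-1)%N (behead w)}.

Definition tree_word (v : tree_vertex) : seq 'I_n := val (val v).

Definition is_child (v w : tree_vertex) : bool :=
  [exists i : 'I_n, tree_word w == rcons (tree_word v) i].

Definition tree_adj : rel tree_vertex := fun v w => is_child v w || is_child w v.

Fact tree_adj_sym : ssrbool.symmetric tree_adj.
Proof. by move=> v w; rewrite /tree_adj orbC. Qed.

Fact tree_adj_irr : irreflexive tree_adj.
Proof.
move=> v; rewrite /tree_adj orbb; apply/existsP => -[i /eqP/(congr1 size)].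
by rewrite size_rcons => /eqP; rewrite eqn_leq ltnn andbF.
Qed.

Definition perfect_tree : sgraph := SGraph tree_adj_sym tree_adj_irr.
End PerfectSemiregularTree.

(* Main.v *)
Require Import Defs.
From mathcomp Require Import all_boot all_order all_algebra.
From mathcomp Require Import generic_quotient ring_quotient.
From mathcomp Require Import boolp ring lra zify.
From mathcomp Require Import mpoly.

(** Let [T = T_{n,k}], let [W] be the set of vertices whose level is [k - 1] modulo 3, and
    let [D] be [W], together with the root if 3 divides [k]; the claimed value is [#|D|].
    [D] is a maximal independent set.  For [w] in [D] let [c w] be a child of [w] if [w]
    is in [W] and [c w = w] otherwise: the closed neighbourhoods [B w] of the vertices
    [c w] are pairwise disjoint, so every maximal independent set, which meets each
    [B w], has at least [#|D|] elements.

    Lower bounds.  For a leaf [l] of an induced subforest [A] with neighbour [v], the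
    maximal independent sets of [A - v] and of [A - N(v)] are maximal independent sets
    of [A].  Induction along [0 -> S/(I_A : x_v) -> S/I_A -> S/(I_A, x_v) -> 0], whose
    outer terms belong to [A - N(v)] and [A - v], gives a Stanley decomposition of [S/I]
    indexed by maximal independent sets, and shows that the linear forms
    [f_w = sum of x_i, i in B w] are a regular sequence, since modulo the prime of a
    maximal independent set they are nonzero with disjoint supports.

    Upper bounds.  A Stanley space that contains a high power of the squarefree monomial
    of [D] has dimension [#|D|].  The product [u] of the variables in [W] is killed by
    the maximal ideal modulo [I + (f_w)], and is nonzero there: map [x_w] to [t_w],
    [x_(c w)] to [- t_w] for [w] in [W], and the other variables to 0.  So the
    sequence [f_w] is maximal, and all maximal regular sequences have the same length
    by Kaplansky's exchange argument, which needs the Hilbert basis theorem. *)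

Set Implicit Arguments.
Unset Strict Implicit.
Unset Printing Implicit Defensive.

Import Order.TTheory GRing.Theory Num.Theory.
Local Open Scope ring_scope.
Local Open Scope quotient_scope.

(** * Regular sequences modulo an ideal *)

Section RegularSequences.
Variable R : comNzRingType.
Implicit Types (J L m : R -> Prop) (f g x : R) (fs gs : seq R).

(** Ideals are bare predicates, so that the successive quotients along a regular sequence are
    handled inside [R] itself. *)
Definition is_ideal J := J 0 /\ forall a p q, J p -> J q -> J (a * p + q).

Definition adjoin J f : R -> Prop := fun p => exists a, J (p - a * f).

Definition adjoins J fs := foldl adjoin J fs.

Definition colon J f : R -> Prop := fun p => J (f * p).

Definition nonzerodivisor J f := forall p, J (f * p) -> J p.

(** This records the nonzerodivisor conditions; that the last quotient is nonzero is supplied by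
    [proper_adjoins]. *)
Fixpoint regular J fs :=
  if fs is f :: fs' then nonzerodivisor J f /\ regular (adjoin J f) fs' else True.

(** A nonzero element of [R/J] killed by [m] certifies that no element of [m] is a nonzerodivisor on
    [R/J]. *)
Definition has_socle m J := exists u, ~ J u /\ forall a, m a -> J (a * u).

Lemma idealM J a p : is_ideal J -> J p -> J (a * p).
Proof. by move=> [J0 JM] Jp; have := JM a p 0 Jp J0; rewrite addr0. Qed.

Lemma idealD J p q : is_ideal J -> J p -> J q -> J (p + q).
Proof. by move=> [J0 JM] Jp Jq; have := JM 1 p q Jp Jq; rewrite mul1r. Qed.

Lemma idealN J p : is_ideal J -> J p -> J (- p).
Proof. by move=> iJ Jp; rewrite -mulN1r; apply: idealM. Qed.

Lemma idealB J p q : is_ideal J -> J p -> J q -> J (p - q).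
Proof. by move=> iJ Jp Jq; apply: idealD => //; apply: idealN. Qed.

Lemma ideal_sum J (T : Type) (r : seq T) (P : pred T) (F : T -> R) :
  is_ideal J -> (forall i, P i -> J (F i)) -> J (\sum_(i <- r | P i) F i).
Proof. by move=> iJ JF; elim/big_ind: _ => //; [case: iJ|move=> *; apply: idealD]. Qed.

Lemma adjoin_ideal J f : is_ideal J -> is_ideal (adjoin J f).
Proof.
move=> iJ; split=> [|a p q [b Jp] [c Jq]]; first by exists 0; rewrite mul0r subr0; case: iJ.
by exists (a * b + c); have := iJ.2 a _ _ Jp Jq; congr J; ring.
Qed.

Lemma adjoin_sub J f p : J p -> adjoin J f p.
Proof. by move=> Jp; exists 0; rewrite mul0r subr0. Qed.

Lemma adjoin_mem J f : is_ideal J -> adjoin J f f.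
Proof. by move=> [J0 _]; exists 1; rewrite mul1r subrr. Qed.

Lemma adjoinC J f g : adjoin (adjoin J f) g = adjoin (adjoin J g) f.
Proof.
apply/funext => p; apply/propext.
by split=> -[a [b Jp]]; exists b, a; rewrite addrAC.
Qed.

Lemma adjoins_ideal J fs : is_ideal J -> is_ideal (adjoins J fs).
Proof. by elim: fs J => //= f fs IH J iJ; apply/IH/adjoin_ideal. Qed.

Lemma adjoins_sub J fs p : J p -> adjoins J fs p.
Proof. by elim: fs J => //= f fs IH J Jp; apply/IH/adjoin_sub. Qed.

Lemma adjoins_mem J fs f : is_ideal J -> f \in fs -> adjoins J fs f.
Proof.
elim: fs J => //= g fs IH J iJ; rewrite inE => /orP[/eqP->|].
  exact/adjoins_sub/adjoin_mem.
exact/IH/adjoin_ideal.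
Qed.

Lemma adjoins_min J L fs p : is_ideal L -> (forall q, J q -> L q) ->
  (forall f, f \in fs -> L f) -> adjoins J fs p -> L p.
Proof.
move=> iL; elim: fs J => [|f fs IH] J JL fL /=; first exact: JL.
apply: IH => [q [a Jq]|g gfs]; last by apply: fL; rewrite inE gfs orbT.
rewrite -[q](subrK (a * f)); apply: idealD => //; first exact: JL.
by apply: idealM => //; apply: fL; rewrite mem_head.
Qed.

Lemma adjoins_rcons J fs g : adjoins J (rcons fs g) = adjoin (adjoins J fs) g.
Proof. by rewrite /adjoins foldl_rcons. Qed.

Lemma adjoins_adjoin J f fs : adjoins (adjoin J f) fs = adjoin (adjoins J fs) f.
Proof. by elim: fs J => //= g fs IH J; rewrite adjoinC IH. Qed.

Lemma regular_cat J fs gs :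
  regular J (fs ++ gs) <-> regular J fs /\ regular (adjoins J fs) gs.
Proof.
elim: fs J => [|f fs IH] J /=; first by split=> [|[]].
by rewrite IH; split=> [[? []]|[[]]].
Qed.

Lemma regular_rcons J fs g :
  regular J (rcons fs g) <-> regular J fs /\ nonzerodivisor (adjoins J fs) g.
Proof. by rewrite -cats1 regular_cat /=; split=> [[? []]|[]]. Qed.

Lemma regular_nth J fs i : regular J fs -> (i < size fs)%N ->
  nonzerodivisor (adjoins J (take i fs)) fs`_i.
Proof.
elim: fs J i => // f fs IH J [|i] /= [rf rfs] //.
by rewrite ltnS; apply: IH.
Qed.

Lemma regular_nthP J fs : regular J fs <->
  forall i, (i < size fs)%N -> nonzerodivisor (adjoins J (take i fs)) fs`_i.
Proof.
split=> [rfs i|]; first exact: regular_nth.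
elim: fs J => //= f fs IH J rfs; split; first exact: (rfs 0%N).
by apply: IH => i ifs; apply: (rfs i.+1).
Qed.

Lemma regular_take J fs i : regular J fs -> regular J (take i fs).
Proof. by rewrite -{1}(cat_take_drop i fs) regular_cat => -[]. Qed.

(** It suffices to swap [z] with the head [f]: if [f p = c z] modulo [J], then [c = e f] modulo [J]
    because [z] is regular modulo [(J, f)], and cancelling [f] gives [p = e z]. *)
Lemma regular_cons J fs z : is_ideal J -> regular J fs ->
  (forall i, (i <= size fs)%N -> nonzerodivisor (adjoins J (take i fs)) z) ->
  regular J (z :: fs).
Proof.
elim: fs J => [|f fs IH] J iJ /=; first by move=> _ /(_ 0%N isT).
move=> [rf rfs] rz; split; first by have /= := rz 0%N isT.
have [rz1 rfs1] := IH _ (adjoin_ideal f iJ) rfs (fun i => rz i.+1).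
split=> [p [c Jp]|]; last by rewrite adjoinC.
have [e Je] : adjoin J f c.
  by apply: rz1; exists p; have := idealN iJ Jp; congr J; ring.
exists e; apply: rf; have := idealD iJ Jp (idealM z iJ Je); congr J; ring.
Qed.

(* The snake lemma for [0 -> R/(J:x) -> R/J -> R/(J,x) -> 0], where the first
   map is multiplication by [x]. *)
Lemma regular_colon_adjoin J x fs : is_ideal J ->
  regular (colon J x) fs -> regular (adjoin J x) fs -> regular J fs.
Proof.
elim: fs J => [|f fs IH] J iJ //= [cf cfs] [af afs].
split=> [p Jfp|].
  have [a Ja] : adjoin J x p by apply/af/adjoin_sub.
  have : colon J x a.
    apply: cf; rewrite /colon; have := idealB iJ Jfp (idealM f iJ Ja).
    by congr J; ring.
  by rewrite /colon => xa; have := idealD iJ Ja xa; congr J; ring.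
apply: IH; [exact: adjoin_ideal| |by rewrite adjoinC].
suff -> : colon (adjoin J f) x = adjoin (colon J x) f by [].
apply/funext => p; apply/propext; split=> [[a Jp]|[a Jp]]; last first.
  by exists (x * a); move: Jp; rewrite /colon; congr J; ring.
have [b Jb] : adjoin J x a.
  by apply: af; exists p; have := idealN iJ Jp; congr J; ring.
exists b; rewrite /colon.
by have := idealD iJ Jp (idealM f iJ Jb); congr J; ring.
Qed.

(** A socle element [u] modulo [f] satisfies [g u = f v] modulo [J] for some [v]; cancelling [f] and
    [g] shows that [v] is a socle element modulo [g]. *)
Lemma socle_exchange m J f g : is_ideal J -> m f -> m g ->
  nonzerodivisor J f -> nonzerodivisor J g ->
  has_socle m (adjoin J f) -> has_socle m (adjoin J g).
Proof.
move=> iJ mf mg rf rg [u [nu su]].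
have [v Jv] := su g mg.
exists v; split=> [[w Jw]|a ma].
  apply: nu; exists w; apply: rg.
  by have := idealD iJ Jv (idealM f iJ Jw); congr J; ring.
have [b Jb] := su a ma; exists b; apply: rf.
have := idealB iJ (idealM g iJ Jb) (idealM a iJ Jv); congr J; ring.
Qed.

End RegularSequences.

(** * Exchange of maximal regular sequences over a Noetherian ring *)

Definition noetherian (R : comNzRingType) := forall A : R -> Prop, is_ideal A ->
  exists s : seq R, (forall a, a \in s -> A a) /\
    forall p, A p -> adjoins (fun q => q = 0) s p.

Lemma In_map (T : eqType) (U : Type) (F : T -> U) (s : seq T) (x : U) :
  List.In x [seq F i | i <- s] <-> exists2 i, i \in s & x = F i.
Proof.
elim: s => [|i s IH] /=; first by split=> // -[].
split=> [[<-|/IH[j js ->]]|[j]].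
- by exists i; rewrite ?mem_head.
- by exists j; rewrite ?inE ?js ?orbT.
by rewrite inE => /orP[/eqP->|js xE]; [left|right; apply/IH; exists j].
Qed.

Lemma In_cat (U : Type) (s t : seq U) (x : U) :
  List.In x (s ++ t) <-> List.In x s \/ List.In x t.
Proof. by elim: s => [|y s IH] /=; [split=> [|[]//]; right|rewrite IH or_assoc]. Qed.

Section NoetherianRings.
Variable R : comNzRingType.
Hypothesis noethR : noetherian R.
Implicit Types (J P m : R -> Prop) (f g u v z : R) (fs gs : seq R).

Lemma zero_ideal : is_ideal (fun q : R => q = 0).
Proof. by split=> // a p q -> ->; rewrite mulr0 addr0. Qed.

Lemma colon_ideal J u : is_ideal J -> is_ideal (colon J u).
Proof.
move=> iJ; split=> [|a p q Jp Jq]; first by rewrite /colon mulr0; case: iJ.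
by have := iJ.2 a _ _ Jp Jq; rewrite /colon; congr J; ring.
Qed.

Lemma colonC J u v : colon J u v = colon J v u.
Proof. by rewrite /colon mulrC. Qed.

(** [J : v] is maximal among the annihilators of nonzero elements of [R/J]; such ideals are prime,
    and finitely many of them cover the zero divisors. *)
Definition colon_maximal J v := ~ J v /\ forall w, ~ J w ->
  (forall a, colon J v a -> colon J w a) -> forall a, colon J w a -> colon J v a.

Definition is_prime P := forall a b, P (a * b) -> P a \/ P b.

Lemma exists_colon_maximal J u : is_ideal J -> ~ J u ->
  exists v, colon_maximal J v /\ forall a, colon J u a -> colon J v a.
Proof.
move=> iJ nu; apply: contrapT => noV.
pose T := {v | ~ J v /\ forall a, colon J u a -> colon J v a}.
(* If no maximal annihilator contains [J : u], every annihilator above it can be strictly enlarged;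
   iterating [g] builds a strictly ascending chain. *)
have /choice[g hg] : forall t : T, exists t' : T,
    (forall a, colon J (sval t) a -> colon J (sval t') a) /\
    exists a, colon J (sval t') a /\ ~ colon J (sval t) a.
  move=> [v [nv uv]]; apply: contrapT => nog; apply: noV; exists v; split=> //.
  split=> // w nw vw a wa; apply: contrapT => nva; apply: nog.
  have hw : ~ J w /\ forall a, colon J u a -> colon J w a by split=> // b /uv/vw.
  by exists (exist _ w hw); split=> //=; exists a.
have hu : ~ J u /\ forall a, colon J u a -> colon J u a by [].
pose s n := sval (iter n g (exist _ u hu)).
have smono n n' a : (n <= n')%N -> colon J (s n) a -> colon J (s n') a.
  move=> /subnKC <-; elim: (n' - n)%N => [|i IH]; first by rewrite addn0.
  by move=> /IH; rewrite addnS; apply: (hg _).1.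
have iA : is_ideal (fun a => exists n, colon J (s n) a).
  split=> [|a p q [i Jp] [j Jq]]; first by exists 0%N; exact: (colon_ideal _ iJ).1.
  exists (maxn i j); apply: (colon_ideal _ iJ).2.
    by apply: smono Jp; apply: leq_maxl.
  by apply: smono Jq; apply: leq_maxr.
have [l [lA Al]] := noethR iA.
(* The union of the chain is finitely generated, so one member already contains it. *)
have [n ln] : exists n, forall a, a \in l -> colon J (s n) a.
  elim: l lA {Al} => [|b l IH] lA; first by exists 0%N.
  have [i li] : exists n, forall a, a \in l -> colon J (s n) a.
    by apply: IH => a al; apply: lA; rewrite inE al orbT.
  have [j bj] := lA b (mem_head _ _).
  exists (maxn i j) => a; rewrite inE => /orP[/eqP->|/li].
    by apply: smono bj; apply: leq_maxr.
  by apply: smono; apply: leq_maxl.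
have [a [sa nsa]] := (hg (iter n g (exist _ u hu))).2.
have : adjoins (fun q => q = 0) l a by apply: Al; exists n.+1.
move/(adjoins_min (colon_ideal (s n) iJ)) => la; apply: nsa; apply: la => //.
by move=> q ->; exact: (colon_ideal _ iJ).1.
Qed.

(** If [a] does not kill [v], then [v a] is nonzero with an annihilator at least as large, hence the
    same; it contains [b]. *)
Lemma colon_maximal_prime J v : is_ideal J -> colon_maximal J v -> is_prime (colon J v).
Proof.
move=> iJ [nv maxv] a b Jab; have [Ja|nJa] := pselect (colon J v a); [by left|right].
apply: (maxv (v * a)) => // [c vc|]; last by move: Jab; rewrite /colon mulrA.
by have := idealM a iJ vc; rewrite /colon; congr J; ring.
Qed.

Lemma prime_sub_separate J P (s : seq R) : is_ideal J -> is_ideal P ->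
  is_prime P -> ~ P 1 ->
  (forall v, v \in s -> exists a, colon J v a /\ ~ P a) ->
  exists a, ~ P a /\ forall v, v \in s -> colon J v a.
Proof.
move=> iJ iP pP P1; elim: s => [|v s IH] hs; first by exists 1.
have [a [na sa]] : exists a, ~ P a /\ forall v, v \in s -> colon J v a.
  by apply: IH => w ws; apply: hs; rewrite inE ws orbT.
have [b [vb nb]] := hs v (mem_head _ _).
exists (a * b); split=> [/pP[]//|w]; rewrite inE => /orP[/eqP->|ws].
  exact: idealM (colon_ideal _ iJ) vb.
by rewrite mulrC; apply: idealM (colon_ideal _ iJ) (sa _ ws).
Qed.

Lemma span_sub (s t : seq R) p : {subset s <= t} ->
  adjoins (fun q => q = 0) s p -> adjoins (fun q => q = 0) t p.
Proof.
move=> st; apply: adjoins_min => [|q ->|f /st ft].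
- exact: adjoins_ideal zero_ideal.
- exact: (adjoins_ideal t zero_ideal).1.
- by apply: adjoins_mem ft; exact: zero_ideal.
Qed.

(** The elements with maximal annihilator generate an ideal, and finitely many of them, [s], already
    generate it; the annihilators of these are enough. *)
Lemma finite_colon_maximal J : is_ideal J -> exists s : seq R,
  (forall v, v \in s -> colon_maximal J v) /\
  forall u z, ~ J u -> colon J u z -> exists2 v, v \in s & colon J v z.
Proof.
move=> iJ.
pose A p := exists2 t : seq R, (forall v, v \in t -> colon_maximal J v)
  & adjoins (fun q => q = 0) t p.
have iA : is_ideal A.
  split=> [|a p q [t tm tp] [t' tm' tq]]; first by exists [::].
  exists (t ++ t') => [v|]; first by rewrite mem_cat => /orP[/tm|/tm'].
  apply: (adjoins_ideal _ zero_ideal).2; [apply: span_sub tp|apply: span_sub tq] => v vt;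
    by rewrite mem_cat vt ?orbT.
have [l [lA Al]] := noethR iA.
have [s sm sl] : exists2 s : seq R, (forall v, v \in s -> colon_maximal J v) &
    forall a, a \in l -> adjoins (fun q => q = 0) s a.
  elim: l lA {Al} => [|b l IH] lA; first by exists [::].
  have [s sm sl] := IH (fun a al => lA a (mem_behead (s := b :: l) al)).
  have [t tm tb] := lA b (mem_head _ _).
  exists (t ++ s) => [v|a]; first by rewrite mem_cat => /orP[/tm|/sm].
  rewrite inE => /orP[/eqP->|/sl]; [move: tb|]; apply: span_sub => v vt;
    by rewrite mem_cat vt ?orbT.
exists s; split=> // u z nu uz.
have [v [vmax uv]] := exists_colon_maximal iJ nu.
have vs : adjoins (fun q => q = 0) s v.
  have : A v.
    exists [:: v]; first by move=> w; rewrite inE => /eqP->.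
    by apply: adjoins_mem; rewrite ?mem_head //; exact: zero_ideal.
  move=> /Al; apply: adjoins_min => //; first exact: adjoins_ideal zero_ideal.
  by move=> q ->; exact: (adjoins_ideal _ zero_ideal).1.
(* Otherwise no [J : w] with [w] in [s] lies in the prime [J : v], so a product of elements outside
   that prime kills all of [s], hence also [v], which is in its span. *)
apply: contrapT => noz.
have [||a [nva sa]] := @prime_sub_separate J (colon J v) s iJ (colon_ideal v iJ)
    (colon_maximal_prime iJ vmax).
- by rewrite /colon mulr1; case: vmax.
- move=> w ws; apply: contrapT => now; apply: noz; exists w => //.
  have [nw wmax] := sm w ws; apply: (wmax v vmax.1) (uv _ uz) => a wa.
  by apply: contrapT => nva; apply: now; exists a.
apply: nva; rewrite colonC.
apply: adjoins_min vs; first exact: colon_ideal.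
  by move=> q ->; exact: (colon_ideal a iJ).1.
by move=> w ws; rewrite colonC; apply: sa.
Qed.

Lemma prime_avoidance m (Ps : seq (R -> Prop)) : is_ideal m ->
  (forall P, List.In P Ps -> [/\ is_ideal P, is_prime P & exists2 a, m a & ~ P a]) ->
  exists2 z, m z & forall P, List.In P Ps -> ~ P z.
Proof.
move=> im; elim: Ps => [|P Ps IH] hPs; first by exists 0 => //; case: im.
have [z mz zPs] := IH (fun Q QPs => hPs Q (or_intror QPs)).
have [iP pP [a ma Pa]] := hPs P (or_introl erefl).
have [Pz|nPz] := pselect (P z); last by exists z => // Q [<-|/zPs].
(* Adding [y] moves [z] out of [P] and spoils no other prime: [y] lies in every [Q] not contained in
   [P], and a [Q] contained in [P] is avoided once [P] is. *)
have [y [my Py yPs]] : exists y, [/\ m y, ~ P y & forall Q, List.In Q Ps ->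
    (exists2 b, Q b & ~ P b) -> Q y].
  elim: Ps hPs {IH zPs} => [|Q Ps IH] hPs; first by exists a.
  have [|y [my Py yPs]] := IH.
    by move=> Q' [<-|Q'Ps]; [apply: hPs; left|apply: hPs; right; right].
  have [[b Qb Pb]|noQ] := pselect (exists2 b, Q b & ~ P b); last first.
    by exists y; split=> // Q' [<- //|/yPs].
  exists (b * y); split; [exact: idealM|by case/pP|move=> Q' [<- _|Q'Ps Q'P]].
    by rewrite mulrC; apply: idealM Qb; have [|] := hPs Q; [right; left|].
  by apply: idealM (yPs _ Q'Ps Q'P); have [|] := hPs Q'; [right; right|].
have Pzy : ~ P (z + y) by move=> Pzy; apply: Py; rewrite -[y](addKr z) addrC; apply: idealB.
exists (z + y); first exact: idealD.
move=> Q [<- //|QPs Qzy]; have [iQ _ _] := hPs Q (or_intror QPs).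
have [QP|noQ] := pselect (exists2 b, Q b & ~ P b); last first.
  by apply: noQ; exists (z + y).
by apply: (zPs Q QPs); rewrite -[z](addrK y); apply: idealB (yPs _ QPs QP).
Qed.

(** Without a socle, [m] lies in none of the finitely many primes covering the zero divisors modulo
    each [J]; prime avoidance treats all the [J] at once. *)
Lemma common_nonzerodivisor m (Js : seq (R -> Prop)) : is_ideal m ->
  (forall J, List.In J Js -> is_ideal J /\ ~ has_socle m J) ->
  exists2 z, m z & forall J, List.In J Js -> nonzerodivisor J z.
Proof.
move=> im hJs.
have [Ps [hPs PsJ]] : exists Ps : seq (R -> Prop),
    (forall P, List.In P Ps -> [/\ is_ideal P, is_prime P & exists2 a, m a & ~ P a]) /\
    forall z, (forall P, List.In P Ps -> ~ P z) ->
      forall J, List.In J Js -> nonzerodivisor J z.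
  elim: Js hJs => [|J Js IH] hJs; first by exists [::].
  have [Ps [hPs PsJ]] := IH (fun J' h => hJs J' (or_intror h)).
  have [iJ nsJ] := hJs J (or_introl erefl).
  have [s [sm sz]] := finite_colon_maximal iJ.
  exists ([seq colon J v | v <- s] ++ Ps)%SEQ; split=> [P|z hz].
    rewrite In_cat => -[/In_map[v vs ->]|/hPs //].
    have vm := sm v vs.
    split; [exact: colon_ideal|exact: colon_maximal_prime|].
    apply: contrapT => noa; apply: nsJ; exists v; split; first by case: vm.
    move=> a ma; apply: contrapT => nJ; apply: noa; exists a => //.
    by rewrite /colon mulrC.
  move=> J' [<-|]; last first.
    by apply: PsJ => P PPs; apply: hz; rewrite In_cat; right.
  move=> u zu; apply: contrapT => nu.
  have [|v vs vz] := sz u z nu; first by rewrite colonC.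
  apply: (hz (colon J v)) vz; rewrite In_cat; left.
  by apply/In_map; exists v.
by have [z mz zPs] := prime_avoidance im hPs; exists z => //; apply: PsJ.
Qed.

Lemma regular_no_socle m J fs i : regular J fs -> (forall f, f \in fs -> m f) ->
  (i < size fs)%N -> ~ has_socle m (adjoins J (take i fs)).
Proof.
move=> rfs mfs ifs [u [nu su]]; apply: nu; apply: (regular_nth rfs ifs).
by apply: su; apply/mfs/mem_nth.
Qed.

(* Kaplansky's argument: a common nonzerodivisor [z] on all the intermediate
   quotients of both sequences can replace their last terms and then be moved
   to the front, which allows induction modulo [z]. *)
Lemma regular_socle_exchange m J fs gs : is_ideal m -> is_ideal J ->
  regular J fs -> regular J gs -> (forall f, f \in fs -> m f) ->
  (forall g, g \in gs -> m g) -> size fs = size gs ->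
  has_socle m (adjoins J fs) -> has_socle m (adjoins J gs).
Proof.
move=> im; elim/last_ind: fs J gs => [|fs f IH] J gs iJ; first by case: gs.
case/lastP: gs => [|gs g]; first by rewrite size_rcons.
move=> rf rg mf mg; rewrite !size_rcons => -[szE].
have [z mz hz] : exists2 z, m z & forall K, List.In K
    ([seq adjoins J (take i fs) | i <- iota 0 (size fs).+1] ++
     [seq adjoins J (take i gs) | i <- iota 0 (size gs).+1])%SEQ -> nonzerodivisor K z.
  apply: common_nonzerodivisor => // K.
  rewrite In_cat => -[] /In_map[i + ->]; rewrite mem_iota ltnS => ile.
    split; first exact: adjoins_ideal.
    suff -> : take i fs = take i (rcons fs f).
      by apply: regular_no_socle => //; rewrite size_rcons ltnS.
    by rewrite -cats1 takel_cat.
  split; first exact: adjoins_ideal.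
  suff -> : take i gs = take i (rcons gs g).
    by apply: regular_no_socle => //; rewrite size_rcons ltnS.
  by rewrite -cats1 takel_cat.
have hzf i : (i <= size fs)%N -> nonzerodivisor (adjoins J (take i fs)) z.
  move=> ile; apply: hz; rewrite In_cat; left; apply/In_map.
  by exists i; rewrite ?mem_iota ?ltnS.
have hzg i : (i <= size gs)%N -> nonzerodivisor (adjoins J (take i gs)) z.
  move=> ile; apply: hz; rewrite In_cat; right; apply/In_map.
  by exists i; rewrite ?mem_iota ?ltnS.
have zf := hzf _ (leqnn _); have zg := hzg _ (leqnn _); rewrite take_size in zf.
rewrite take_size in zg.
move/regular_rcons: rf => [rfs rf]; move/regular_rcons: rg => [rgs rg].
have mfs x : x \in fs -> m x by move=> xs; apply: mf; rewrite mem_rcons inE xs orbT.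
have mgs x : x \in gs -> m x by move=> xs; apply: mg; rewrite mem_rcons inE xs orbT.
have mf1 : m f by apply: mf; rewrite mem_rcons mem_head.
have mg1 : m g by apply: mg; rewrite mem_rcons mem_head.
rewrite !adjoins_rcons => sf.
apply: (@socle_exchange _ m _ z) => //; first exact: adjoins_ideal.
have {}sf : has_socle m (adjoin (adjoins J fs) z).
  by apply: socle_exchange sf => //; exact: adjoins_ideal.
move: sf; rewrite -!adjoins_adjoin; apply: IH => //; first exact: adjoin_ideal.
  by have [] := regular_cons iJ rfs hzf.
by have [] := regular_cons iJ rgs hzg.
Qed.

(** Maximality of [gs] forces a socle modulo [gs]. If the lengths differed, the exchange would give
    the longer sequence, cut to the shorter length, a socle, which its next term excludes. *)
Lemma regular_maximal_size m J fs gs : is_ideal m -> is_ideal J ->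
  regular J fs -> regular J gs -> (forall f, f \in fs -> m f) ->
  (forall g, g \in gs -> m g) -> has_socle m (adjoins J fs) ->
  (forall g, m g -> ~ regular J (rcons gs g)) -> size gs = size fs.
Proof.
move=> im iJ rf rg mf mg sf maxg.
have sg : has_socle m (adjoins J gs).
  apply: contrapT => nsg.
  have [|z mz hz] := @common_nonzerodivisor m [:: adjoins J gs] im.
    by move=> K [<-|[]]; split=> //; exact: adjoins_ideal.
  by apply: (maxg z mz); apply/regular_rcons; split=> //; apply: hz; left.
case: (ltngtP (size gs) (size fs)) => // lt.
  case: (regular_no_socle rf mf lt).
  apply: regular_socle_exchange sg => //; first exact: regular_take.
    by move=> f /mem_take /mf.
  by rewrite size_takel // ltnW.
case: (regular_no_socle rg mg lt).
apply: regular_socle_exchange sf => //; first exact: regular_take.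
  by move=> f /mem_take /mg.
by rewrite size_takel // ltnW.
Qed.

End NoetherianRings.

(** * Hilbert's basis theorem *)

Section Dickson.
Variable n : nat.
Implicit Types (m : 'X_{1..n}) (h : nat -> 'X_{1..n}).

(** Every tail attains a minimum, and [phi] jumps from one tail minimum to the next. *)
Lemma nat_nondecreasing_subsequence (u : nat -> nat) : exists phi : nat -> nat,
  (forall i j, (i < j)%N -> (phi i < phi j)%N) /\
  forall i j, (i <= j)%N -> (u (phi i) <= u (phi j))%N.
Proof.
have tail_min N0 : exists i, (N0 <= i)%N /\ forall j, (i <= j)%N -> (u i <= u j)%N.
  have [v] := ubnP (u N0); elim: v N0 => // v IH N0 uv.
  have [[j Nj uj]|noj] := pselect (exists2 j, (N0 <= j)%N & (u j < u N0)%N).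
    have [|i [ji imin]] := IH j; first exact: leq_trans uj _.
    by exists i; split=> //; exact: leq_trans ji.
  exists N0; split=> // j Nj; rewrite leqNgt; apply/negP => uj; apply: noj.
  by exists j.
have [c hc] := choice tail_min.
pose phi := fix phi k := if k is k'.+1 then c (phi k').+1 else c 0%N.
have phiS k : (phi k < phi k.+1)%N by case: (hc (phi k).+1).
have phi_lt i j : (i < j)%N -> (phi i < phi j)%N.
  by apply: (homo_ltn ltn_trans).
exists phi; split=> // i j; rewrite leq_eqVlt => /orP[/eqP-> //|ij].
case: i ij => [|i] ij; apply: (hc _).2; first exact/ltnW/(phi_lt 0%N).
exact/ltnW/(phi_lt i.+1).
Qed.

Lemma mnm_nondecreasing_pair h : exists i j, (i < j)%N /\ (h i <= h j)%MM.
Proof.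
(* [c] counts the coordinates already made nondecreasing along one common subsequence. *)
suff H c : exists phi : nat -> nat, (forall i j, (i < j)%N -> (phi i < phi j)%N) /\
    forall (k : 'I_n), (k < c)%N -> forall i j, (i <= j)%N ->
      (h (phi i) k <= h (phi j) k)%N.
  have [phi [phi_lt hphi]] := H n; exists (phi 0%N), (phi 1%N).
  by split; [exact: phi_lt|apply/mnm_lepP => k; apply: hphi].
elim: c => [|c [phi [phi_lt hphi]]]; first by exists id.
have [cn|nc] := ltnP c n; last first.
  by exists phi; split=> // k _; apply: hphi; apply: leq_trans nc.
have [psi [psi_lt hpsi]] :=
  nat_nondecreasing_subsequence (fun i => h (phi i) (Ordinal cn)).
exists (phi \o psi); split=> [i j /psi_lt/phi_lt //|k kc i j ij] /=.
have psi_le : (psi i <= psi j)%N.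
  by move: ij; rewrite leq_eqVlt => /orP[/eqP-> //|/psi_lt/ltnW].
move: kc; rewrite ltnS leq_eqVlt => /orP[/eqP kc|kc]; last exact: hphi.
by have := hpsi i j ij; congr (h _ _ <= h _ _)%N; apply/val_inj.
Qed.

(** Otherwise every finite part of [L] leaves an element of [L] that none of its members divides;
    adding these one by one contradicts [mnm_nondecreasing_pair]. *)
Lemma dickson (L : 'X_{1..n} -> Prop) : exists s : seq 'X_{1..n},
  (forall m, m \in s -> L m) /\ forall m, L m -> exists2 m', m' \in s & (m' <= m)%MM.
Proof.
apply: contrapT => noS.
pose T := {s : seq 'X_{1..n} | forall m, m \in s -> L m}.
have /choice[g hg] : forall s : T, exists m,
    L m /\ forall m', m' \in sval s -> ~~ (m' <= m)%MM.
  move=> [s sL]; apply: contrapT => nom; apply: noS; exists s; split=> // m Lm.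
  apply: contrapT => nom'; apply: nom; exists m; split=> // m' /= ms.
  by apply/negP => le_m; apply: nom'; exists m'.
have nextL (s : T) m : m \in g s :: sval s -> L m.
  by rewrite inE => /orP[/eqP->|/(svalP s)//]; case: (hg s).
pose next (s : T) : T := exist _ (g s :: sval s) (nextL s).
have nilL m : m \in [::] -> L m by [].
pose s k := iter k next (exist _ [::] nilL).
have [i [j [ij]]] := mnm_nondecreasing_pair (fun k => g (s k)).
apply/negP; apply: (hg (s j)).2.
elim: j ij => // j IH; rewrite ltnS leq_eqVlt /= inE => /orP[/eqP->|/IH ->].
  by rewrite eqxx.
by rewrite orbT.
Qed.
End Dickson.

(** By Dickson's lemma finitely many elements of [A] have leading monomials dividing all the others;
    division by them is an induction on the leading monomial. *)
Lemma mpoly_noetherian (K : fieldType) (n : nat) : noetherian {mpoly K[n]}.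
Proof.
move=> A iA.
have [s [sL Ls]] := @dickson n (fun m => exists p, [/\ A p, p != 0 & mlead p = m]).
have [gs [gsA gss]] : exists gs : seq {mpoly K[n]},
    (forall g, g \in gs -> A g /\ g != 0) /\
    forall m, m \in s -> exists2 g, g \in gs & mlead g = m.
  elim: s sL {Ls} => [|m s IH] sL; first by exists [::].
  have [gs [gsA gss]] := IH (fun m' ms => sL m' (mem_behead (s := m :: s) ms)).
  have [p [Ap p0 pm]] := sL m (mem_head _ _).
  exists (p :: gs); split=> [g|m'].
    by rewrite inE => /orP[/eqP->|/gsA].
  rewrite inE => /orP[/eqP->|/gss[g ggs gm]]; first by exists p; rewrite ?mem_head.
  by exists g; rewrite // inE ggs orbT.
exists gs; split=> [g /gsA[]//|p].
have i0 := adjoins_ideal gs (zero_ideal {mpoly K[n]}).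
elim/mleadrect: p => p IH Ap.
have [->|p0] := eqVneq p 0; first by case: i0.
have [_ /gss[g ggs <-] le_m] := Ls (mlead p) (ex_intro _ p (And3 Ap p0 erefl)).
have [Ag g0] := gsA g ggs.
pose c := p@_(mlead p) / g@_(mlead g).
pose m := (mlead p - mlead g)%MM.
(* [r] is the multiple of [g] with the leading term of [p], so [p - r] is 0 or has a smaller leading
   monomial. *)
pose r := c *: g * 'X_[m].
have c0 : c != 0 by rewrite mulf_neq0 ?invr_eq0 ?mleadc_eq0.
have cg0 : c *: g != 0 by rewrite scaler_eq0 negb_or c0.
have mg : (m + mlead g)%MM = mlead p by rewrite submK.
have X0 : 'X_[m] != 0 :> {mpoly K[n]} by rewrite -msupp_eq0 msuppX.
have rlead : mlead r = mlead p by rewrite mleadM // mleadZ // mleadXm addmC.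
have rlc : r@_(mlead p) = p@_(mlead p).
  by rewrite -mg mcoeffMX mcoeffZ mg divfK ?mleadc_eq0.
have rE : r = c *: 'X_[m] * g by rewrite -scalerAl mulrC scalerAl.
have gsr : adjoins (fun q => q = 0) gs r.
  by rewrite rE; apply: idealM => //; apply: adjoins_mem => //; exact: zero_ideal.
rewrite -[p](subrK r); apply: idealD => //.
have [->|q0] := eqVneq (p - r) 0; first by case: i0.
apply: IH; last by apply: idealB => //; rewrite rE; apply: idealM.
rewrite lt_neqAle; apply/andP; split.
  by apply: contra_neq q0 => ql; apply/eqP; rewrite -mleadc_eq0 ql mcoeffB rlc subrr.
by apply: le_trans (mleadB_le _ _) _; rewrite rlead joinxx.
Qed.

(** * Edge ideals of forests *)

Section Monomials.
Variables (N : nat) (K : fieldType).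
Local Notation S := {mpoly K[N]}.
Implicit Types (m : 'X_{1..N}) (p q : S) (A B X Z : {set 'I_N}).

Lemma mcoeffM_neq0 p q m : (p * q)@_m != 0 ->
  exists m1 m2, [/\ m = (m1 + m2)%MM, p@_m1 != 0 & q@_m2 != 0].
Proof.
rewrite -mcoeff_msupp => /msuppM_le/allpairsP[[m1 m2] /= [m1p m2q ->]].
by exists m1, m2; rewrite -!mcoeff_msupp.
Qed.

Lemma mcoeffXM m m' p : ('X_[m] * p)@_(m + m') = p@_m'.
Proof. by rewrite mulrC mcoeffMX. Qed.

Definition mnm_supp m : {set 'I_N} := [set i | m i != 0%N].

Lemma mnm_suppD m m' : mnm_supp (m + m') = mnm_supp m :|: mnm_supp m'.
Proof. by apply/setP => i; rewrite !inE mnmDE addn_eq0 negb_and. Qed.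

Lemma mnm_supp_le m m' : (m <= m')%MM -> mnm_supp m \subset mnm_supp m'.
Proof. by move/submK <-; rewrite mnm_suppD subsetUr. Qed.

Lemma mnm_suppU i : mnm_supp U_(i) = [set i].
Proof. by apply/setP => j; rewrite !inE mnm1E eqb0 negbK eq_sym. Qed.

Lemma mnm_supp0 : mnm_supp 0%MM = set0.
Proof. by apply/setP => j; rewrite !inE mnm0E. Qed.

Definition linear_form B : S := \sum_(i in B) 'X_i.

Lemma mcoeff_linear_form B j : (linear_form B)@_U_(j) = (j \in B)%:R.
Proof.
rewrite /linear_form raddf_sum /=; under eq_bigr do rewrite mcoeffXU.
have [jB|njB] := boolP (j \in B).
  by rewrite (bigD1 j) //= eqxx big1 ?addr0 // => i /andP[_ /negPf->].
by apply: big1 => i iB; case: eqP => // ij; rewrite -ij iB in njB.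
Qed.

Lemma comp_mpoly_congr (J : S -> Prop) (lq : N.-tuple S) : is_ideal J ->
  (forall i, J ('X_i - tnth lq i)) -> forall p, J (p - (p \mPo lq)).
Proof.
move=> iJ Jlq; have JM p q : J (p - (p \mPo lq)) -> J (q - (q \mPo lq)) ->
    J (p * q - ((p * q) \mPo lq)).
  move=> Jp Jq; rewrite rmorphM /=.
  by have := idealD iJ (idealM q iJ Jp) (idealM (p \mPo lq) iJ Jq); congr J; ring.
have JX m : J ('X_[m] - ('X_[m] \mPo lq)).
  rewrite mpolyXE_id; apply: (big_ind (fun p => J (p - (p \mPo lq)))) => //.
    by rewrite rmorph1 subrr; case: iJ.
  move=> i _; elim: (m i) => [|k IH]; first by rewrite expr0 rmorph1 subrr; case: iJ.
  by rewrite exprS; apply: JM => //; rewrite comp_mpolyXU -tnth_nth.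
move=> p; rewrite {1}[p]mpolyE comp_mpolyEX -sumrB; apply: ideal_sum => // m _.
by rewrite -scalerBr -mul_mpolyC; apply: idealM.
Qed.

(** [S/J] embeds in the domain [S] through [phi], so a form with nonzero image is a nonzerodivisor.
    The ideal with this form adjoined is again a kernel, that of [theta \o phi], and disjointness
    leaves the other forms untouched. *)
Lemma regular_kernel (phi : {rmorphism S -> S}) (J : S -> Prop) A (Bs : seq {set 'I_N}) :
  is_ideal J -> (forall p, J p <-> phi p = 0) -> (forall p, J (p - phi p)) ->
  (forall B, B \in Bs -> phi (linear_form B) = linear_form (B :&: A)) ->
  pairwise (fun B C => [disjoint B & C]) Bs ->
  (forall B, B \in Bs -> B :&: A != set0) ->
  regular J [seq linear_form B | B <- Bs].
Proof.
elim: Bs phi J => // B Bs IH phi J iJ kerJ subJ phiB /= /andP[/allP disB disBs] ne.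
set f := linear_form B; have phif : phi f = linear_form (B :&: A).
  by apply: phiB; rewrite mem_head.
have [b bBA] : exists b, b \in B :&: A by apply/set0Pn/ne/mem_head.
have f'0 : linear_form (B :&: A) != 0.
  apply/eqP => /(congr1 (mcoeff U_(b))); rewrite mcoeff_linear_form bBA mcoeff0.
  by apply/eqP; rewrite oner_eq0.
split=> [p /kerJ|].
  by rewrite rmorphM phif => /eqP; rewrite mulf_eq0 (negPf f'0) => /eqP/kerJ.
(* [X_b] goes to minus the sum of the other variables of [B :&: A], which makes the form vanish. *)
pose lq : N.-tuple S := [tuple if i == b then 'X_b - linear_form (B :&: A) else 'X_i : S | i < N].
pose theta : {rmorphism S -> S} := comp_mpoly lq.
have thetaX i : theta 'X_i = if i == b then 'X_b - linear_form (B :&: A) else 'X_i.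
  by rewrite /theta /= comp_mpolyXU -tnth_nth tnth_mktuple.
have theta_lin (C : {set 'I_N}) : b \notin C -> theta (linear_form C) = linear_form C.
  move=> bC; rewrite rmorph_sum; apply: eq_bigr => i iC /=; rewrite thetaX.
  by case: eqP => // ib; rewrite -ib iC in bC.
have theta_f' : theta (linear_form (B :&: A)) = 0.
  have lE : linear_form (B :&: A) = 'X_b + linear_form ((B :&: A) :\ b).
    rewrite /linear_form (bigD1 b) //=; congr (_ + _); apply: eq_bigl => i.
    by rewrite !inE andbC.
  rewrite {1}lE rmorphD /= (theta_lin ((B :&: A) :\ b)) ?inE ?eqxx // thetaX eqxx.
  by rewrite lE opprD addrA subrr add0r addNr.
have iJf := adjoin_ideal f iJ.
have Jf' : adjoin J f (linear_form (B :&: A)).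
  exists 1; rewrite mul1r -phif -opprB; apply: idealN => //; exact: subJ.
have theta_sub p : adjoin J f (p - theta p).
  apply: comp_mpoly_congr => // i; rewrite tnth_mktuple; case: eqP => [->|_].
    by rewrite opprB addrC subrK.
  by rewrite subrr; case: iJf.
have subJ' p : adjoin J f (p - theta (phi p)).
  have -> : p - theta (phi p) = (p - phi p) + (phi p - theta (phi p)) by rewrite addrA subrK.
  by apply: idealD => //; apply: adjoin_sub.
apply: (IH (theta \o phi)) => //.
- move=> p; split=> [[a /kerJ]|phip].
    rewrite rmorphB rmorphM phif => /eqP; rewrite subr_eq0 => /eqP pE.
    by change (theta (phi p) = 0); rewrite pE rmorphM theta_f' mulr0.
  by have := subJ' p; rewrite (phip : theta (phi p) = 0) subr0.
- move=> C CBs; change (theta (phi (linear_form C)) = linear_form (C :&: A)).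
  rewrite phiB ?inE ?CBs ?orbT // theta_lin //.
  move: bBA; rewrite !inE => /andP[bB _].
  by rewrite (disjointFr (disB _ CBs) bB).
- by move=> C CBs; apply: ne; rewrite inE CBs orbT.
Qed.

End Monomials.

(** * Leaf induction on forests and standard monomials *)

Section Forests.
Variables (N : nat) (e : rel 'I_N).
Hypotheses (e_sym : ssrbool.symmetric e) (e_irr : irreflexive e).
Implicit Types (m : 'X_{1..N}) (A B X Z : {set 'I_N}).

Definition independent X := [forall i in X, forall j in X, ~~ e i j].

Lemma independentP X :
  reflect (forall i j, i \in X -> j \in X -> ~~ e i j) (independent X).
Proof.
apply: (iffP forall_inP) => [h i j iX jX|h i iX].
  by have /forall_inP/(_ j jX) := h i iX.
by apply/forall_inP => j jX; apply: h.
Qed.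

Lemma independent_sub X Z : X \subset Z -> independent Z -> independent X.
Proof.
move=> XZ /independentP iZ; apply/independentP => i j /(subsetP XZ) iX /(subsetP XZ).
exact: iZ.
Qed.

Definition neighbours i : {set 'I_N} := [set j | e i j].

Definition maximal_independent A X := [/\ X \subset A, independent X
  & forall i, i \in A -> i \notin X -> exists2 j, j \in X & e i j].

Definition leaf_at A l v := [/\ l \in A, v \in A, e l v
  & forall j, j \in A -> e l j -> j = v].

Lemma maximal_independent_self A : independent A -> maximal_independent A A.
Proof. by split=> // i -> . Qed.

(** Only the domination of [v] is in question. If [l] were not in [X], a neighbour of [l] in [X]
    would exist, but its only neighbour in [A] is [v]; so [l] dominates [v]. *)
Lemma maximal_independent_deletion A X l v : leaf_at A l v ->
  maximal_independent (A :\ v) X -> maximal_independent A X.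
Proof.
move=> [lA vA lv lmin] [XA iX maxX]; split=> //; first exact: subset_trans XA (subsetDl _ _).
move=> i iA iX'; have [->|iv] := eqVneq i v; last by apply: maxX; rewrite // !inE iv.
have [lX|lX] := boolP (l \in X); first by exists l; rewrite // e_sym.
have lnv : l != v by apply: contraTneq lv => ->; rewrite e_irr.
have [|j jX lj] := maxX l _ lX; first by rewrite !inE lnv.
have /setD1P[jv jA] := subsetP XA _ jX.
by rewrite (lmin j jA lj) eqxx in jv.
Qed.

(** [v] is isolated in [A :\: neighbours v], hence lies in [X] and dominates the removed
    neighbours. *)
Lemma maximal_independent_link A X v : v \in A ->
  maximal_independent (A :\: neighbours v) X -> maximal_independent A X.
Proof.
move=> vA [XA iX maxX]; split=> //; first exact: subset_trans XA (subsetDl _ _).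
move=> i iA iX'; have [iv|iv] := boolP (i \in neighbours v); last first.
  by apply: maxX => //; apply/setDP.
exists v; last by move: iv; rewrite inE e_sym.
apply: contraPT isT => vX; have [|j jX vj] := maxX v _ vX.
  by rewrite !inE e_irr.
by have := subsetP XA _ jX; rewrite !inE vj.
Qed.

Section Rank.
(** A rank under which each vertex has at most one lower neighbour, its parent, certifies that the
    graph is a forest. *)
Variable rank : 'I_N -> nat.
Hypothesis rank_adj : forall i j, e i j -> rank i != rank j.
Hypothesis rank_parent : forall i j j', e i j -> e i j' ->
  (rank j < rank i)%N -> (rank j' < rank i)%N -> j = j'.

(** A non-isolated vertex of [A] of greatest rank has only lower neighbours in [A], hence only its
    parent. *)
Lemma exists_leaf A : ~~ independent A -> exists l v, leaf_at A l v.
Proof.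
pose P i := (i \in A) && [exists j in A, e i j].
move=> niA; have [i0 Pi0] : exists i, P i.
  move: niA; rewrite negb_forall_in => /exists_inP[i iA].
  rewrite negb_forall_in => /exists_inP[j jA]; rewrite negbK => ij.
  by exists i; rewrite /P iA; apply/exists_inP; exists j.
case: (arg_maxnP rank Pi0) => l /andP[lA /exists_inP[v vA lv]] lmax.
have parent j : j \in A -> e l j -> (rank j < rank l)%N.
  move=> jA lj; rewrite ltn_neqAle eq_sym rank_adj //=; apply: lmax.
  by rewrite /P jA; apply/exists_inP; exists l; rewrite // e_sym.
exists l, v; split=> // j jA lj.
by apply: (rank_parent lj lv); apply: parent.
Qed.

Lemma forest_ind (P : {set 'I_N} -> Prop) :
  (forall A, independent A -> P A) ->
  (forall A l v, leaf_at A l v -> P (A :\ v) -> P (A :\: neighbours v) -> P A) ->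
  forall A, P A.
Proof.
move=> Pind Pleaf A; have [k] := ubnP #|A|; elim: k A => // k IH A; rewrite ltnS => Ak.
have [/Pind//|/exists_leaf[l [v lvA]]] := boolP (independent A).
have [lA vA lv _] := lvA.
have sub X : X \proper A -> P X by move=> /proper_card XA; apply/IH/(leq_trans XA).
apply: Pleaf lvA (sub _ _) (sub _ _); first exact: properD1.
apply/properP; split; first exact: subsetDl.
by exists l; rewrite // !inE e_sym lv.
Qed.
End Rank.

Definition standard A m := (mnm_supp m \subset A) && independent (mnm_supp m).

Lemma standard_le A m m' : (m <= m')%MM -> standard A m' -> standard A m.
Proof.
move=> /mnm_supp_le le /andP[sA iA]; apply/andP; split; first exact: subset_trans sA.
exact: independent_sub iA.
Qed.

Lemma standard_link A v m : v \in A ->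
  standard A (U_(v) + m) = standard (A :\: neighbours v) m.
Proof.
move=> vA; rewrite /standard mnm_suppD mnm_suppU subUset sub1set vA /=.
apply/andP/andP => -[sA /independentP iU]; split.
- apply/subsetP => i im; rewrite inE (subsetP sA) // andbT inE.
  by apply: iU; rewrite inE ?set11 // im orbT.
- by apply/independentP => i j im jm; apply: iU; rewrite inE ?im ?jm orbT.
- by apply: subset_trans sA _; apply: subsetDl.
have nv i : i \in mnm_supp m -> ~~ e v i.
  by move=> /(subsetP sA); rewrite !inE => /andP[].
apply/independentP => i j; rewrite !inE => /orP[/eqP->|im] /orP[/eqP->|jm].
- by rewrite e_irr.
- by apply: nv; rewrite inE.
- by rewrite e_sym; apply: nv; rewrite inE.
- by apply: iU; rewrite inE.
Qed.

Lemma standard_deletion A v m : m v = 0%N -> standard A m = standard (A :\ v) m.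
Proof. by move=> mv; rewrite /standard subsetD1 inE mv eqxx /= andbT. Qed.

Lemma mnm_addU_sub v m : m v != 0%N -> m = (U_(v) + (m - U_(v)))%MM.
Proof. by move=> mv; rewrite addmC submK // lep1mP. Qed.

(** Exponents of the monomials of the Stanley space [X^(c.1) K[c.2]]. *)
Definition cone (c : 'X_{1..N} * {set 'I_N}) m :=
  (c.1 <= m)%MM && (mnm_supp (m - c.1) \subset c.2).

Section StandardIdeal.
Variable K : fieldType.
Local Notation S := {mpoly K[N]}.
Implicit Types p q : S.

(* The ideal [I_A] generated by the edge monomials and the variables outside [A];
   [standard A] singles out the monomials that are not in it. *)
Definition standard_ideal A p := forall m, standard A m -> p@_m = 0.

Lemma standard_ideal_ideal A : is_ideal (standard_ideal A).
Proof.
split=> [m _|a p q Jp Jq m sm]; first by rewrite mcoeff0.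
rewrite mcoeffD Jq // addr0; apply/eqP/negPn/negP => /mcoeffM_neq0[m1 [m2 [mE _]]].
rewrite Jp ?eqxx //; apply: standard_le sm; rewrite mE; exact: lem_addl.
Qed.

Lemma colon_standard_ideal A v : v \in A ->
  colon (standard_ideal A) 'X_v = standard_ideal (A :\: neighbours v).
Proof.
move=> vA; apply/funext => p; apply/propext; split=> Jp m sm.
  by rewrite -(mcoeffXM U_(v) m); apply: Jp; rewrite standard_link.
apply/eqP/negPn/negP => /mcoeffM_neq0[m1 [m2 [mE]]]; rewrite mcoeffX.
case: (_ =P m1) => [m1E _|_]; last by rewrite eqxx.
by rewrite Jp ?eqxx // -standard_link // m1E -mE.
Qed.

Lemma adjoin_standard_ideal A v :
  adjoin (standard_ideal A) 'X_v = standard_ideal (A :\ v).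
Proof.
apply/funext => p; apply/propext; split=> [[a Jp] m sm|Jp].
  have mv : m v = 0%N.
    by case/andP: sm => /subsetD1P[_]; rewrite inE negbK => /eqP.
  have := Jp m; rewrite (standard_deletion _ mv) => /(_ sm).
  rewrite mcoeffB => /eqP; rewrite subr_eq0 => /eqP->.
  apply/eqP/negPn/negP => /mcoeffM_neq0[m1 [m2 [mE _]]]; rewrite mcoeffX.
  case: (_ =P m2) => [m2E _|_]; last by rewrite eqxx.
  by move: mv; rewrite mE -m2E mnmDE mnm1E eqxx addn1.
(* The cofactor collects the monomials of [p] divisible by [x_v], divided by it; the rest of [p] is
   in [standard_ideal A]. *)
exists (\sum_(m <- msupp p | m v != 0%N) p@_m *: 'X_[m - U_(v)]) => m sm.
have -> : (\sum_(m <- msupp p | m v != 0%N) p@_m *: 'X_[m - U_(v)]) * 'X_v =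
          \sum_(m <- msupp p | m v != 0%N) p@_m *: 'X_[m] :> S.
  rewrite mulr_suml; apply: eq_bigr => m' mv.
  by rewrite -scalerAl -mpolyXD addmC -mnm_addU_sub.
rewrite {1}[p]mpolyE (bigID (fun m : 'X_{1..N} => m v != 0%N)) /= addrAC subrr add0r.
rewrite raddf_sum /= big_seq_cond big1 // => m' /andP[m'p]; rewrite negbK => /eqP m'v.
rewrite mcoeffZ mcoeffX; case: eqP => [m'm|]; last by rewrite mulr0.
by rewrite m'm Jp ?mul0r // -standard_deletion // -m'm.
Qed.

(** For independent [A] the ideal is the prime generated by the variables outside [A], the kernel of
    the substitution that sets them to 0. *)
Lemma regular_independent A (Bs : seq {set 'I_N}) : independent A ->
  pairwise (fun B C => [disjoint B & C]) Bs ->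
  (forall B, B \in Bs -> B :&: A != set0) ->
  regular (standard_ideal A) [seq linear_form K B | B <- Bs].
Proof.
move=> iA disBs ne.
pose lq : N.-tuple S := [tuple if i \in A then 'X_i else 0 : S | i < N].
have iJ := standard_ideal_ideal A.
have subJ p : standard_ideal A (p - (p \mPo lq)).
  apply: comp_mpoly_congr => // i; rewrite tnth_mktuple.
  case: ifP => [_|/negP iA']; first by rewrite subrr; case: iJ.
  rewrite subr0 => m sm; rewrite mcoeffX; case: eqP => // mE; case: iA'.
  by case/andP: sm; rewrite -mE mnm_suppU sub1set.
apply: (@regular_kernel _ _ (comp_mpoly lq) _ A) => // [p|B BBs]; last first.
  rewrite rmorph_sum /= /linear_form (bigID (mem A)) /= [X in _ + X]big1 ?addr0.
    apply: eq_big => i; first by rewrite inE.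
    by move=> /andP[_ iA']; rewrite comp_mpolyXU -tnth_nth tnth_mktuple iA'.
  by move=> i /andP[_ /negPf iA']; rewrite comp_mpolyXU -tnth_nth tnth_mktuple iA'.
split=> [Jp|/= p0]; last by have := subJ p; rewrite p0 subr0.
rewrite /= comp_mpolyEX big_seq big1 // => m mp.
have : ~~ standard A m by apply: contraTN mp => /Jp/eqP; rewrite mcoeff_eq0.
rewrite /standard; have [mA|/subsetPn[i im iA'] _] := boolP (mnm_supp m \subset A).
  by rewrite (independent_sub mA).
rewrite comp_mpolyX (bigD1 i) //= tnth_mktuple (negPf iA').
by move: im; rewrite inE => im; rewrite expr0n (negPf im) mul0r scaler0.
Qed.

End StandardIdeal.
End Forests.

Section ForestIdeals.
Variables (N : nat) (e : rel 'I_N).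
Hypotheses (e_sym : ssrbool.symmetric e) (e_irr : irreflexive e).
Variable rank : 'I_N -> nat.
Hypothesis rank_adj : forall i j, e i j -> rank i != rank j.
Hypothesis rank_parent : forall i j j', e i j -> e i j' ->
  (rank j < rank i)%N -> (rank j' < rank i)%N -> j = j'.
Implicit Types (m : 'X_{1..N}) (A B X Z : {set 'I_N}).

Lemma regular_forest (K : fieldType) (Bs : seq {set 'I_N}) A :
  pairwise (fun B C => [disjoint B & C]) Bs ->
  (forall X B, maximal_independent e A X -> B \in Bs -> B :&: X != set0) ->
  regular (standard_ideal e (K := K) A) [seq linear_form K B | B <- Bs].
Proof.
move=> disBs; elim/(forest_ind e_sym rank_adj rank_parent): A => [A iA|A l v lvA IHd IHl] hA.
  by apply: regular_independent => // B; apply: hA; apply: maximal_independent_self.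
have [_ vA _ _] := lvA.
apply: (@regular_colon_adjoin _ _ 'X_v); first exact: standard_ideal_ideal.
  rewrite colon_standard_ideal //; apply: IHl => X B mX; apply: hA.
  exact: maximal_independent_link vA mX.
rewrite adjoin_standard_ideal; apply: IHd => X B mX; apply: hA.
exact: maximal_independent_deletion lvA mX.
Qed.

(** Standard monomials of [A] free of [x_v] are those of [A :\ v]; the others are [x_v] times those
    of [A :\: neighbours v]. The count says that the cones are disjoint and cover exactly the
    standard monomials. *)
Lemma cone_partition A : exists L : seq ('X_{1..N} * {set 'I_N}),
  (forall c, c \in L -> maximal_independent e A c.2) /\
  forall m, count (fun c => cone c m) L = standard e A m.
Proof.
elim/(forest_ind e_sym rank_adj rank_parent): A => [A iA|A l v lvA [Ld [Ldm Ldc]] [Ll [Llm Llc]]].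
  exists [:: (0%MM, A)]; split=> [c|m].
    by rewrite inE => /eqP->; apply: maximal_independent_self.
  rewrite /= addn0 /cone /standard /= subm0; congr nat_of_bool.
  have -> : (0 <= m)%MM by apply/mnm_lepP => i; rewrite mnm0E.
  by case: (boolP (_ \subset A)) => // mA; rewrite (independent_sub mA).
have [_ vA _ _] := lvA.
exists (Ld ++ [seq ((U_(v) + c.1)%MM, c.2) | c <- Ll]); split=> [c|m].
  rewrite mem_cat => /orP[/Ldm cm|/mapP[c' /Llm cm ->]].
    exact: maximal_independent_deletion lvA cm.
  exact: maximal_independent_link cm.
rewrite count_cat count_map Ldc; have [mv|mv] := eqVneq (m v) 0%N.
  rewrite -standard_deletion // (eq_count (a2 := pred0)) ?count_pred0 ?addn0 // => c.
  rewrite /cone /=; case: mnm_lepP => // /(_ v).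
  by rewrite mnmDE mnm1E eqxx mv.
have -> : standard e (A :\ v) m = false.
  by apply/negP => /andP[/subsetD1P[_]]; rewrite inE mv.
have mE := mnm_addU_sub mv.
rewrite [in RHS]mE standard_link // -Llc add0n; apply: eq_count => c.
rewrite /cone /= submDA; congr (_ && _).
have mEi i : m i = (U_(v)%MM i + (m - U_(v))%MM i)%N by rewrite -mnmDE -mE.
by apply/mnm_lepP/mnm_lepP => h i; have := h i; rewrite mnmDE mEi leq_add2l.
Qed.

(** * Packings by disjoint closed neighbourhoods *)

Section Packing.
Variables (D W : {set 'I_N}) (c : 'I_N -> 'I_N).
Let B w := c w |: neighbours e (c w).
Hypotheses (WD : W \subset D) (indD : independent e D).
Hypothesis cW : forall w, w \in W -> e w (c w).
Hypothesis cD : forall w, w \in D -> w \notin W -> c w = w.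
Hypothesis disB : forall w w', w \in D -> w' \in D -> w != w' -> [disjoint B w & B w'].
Hypothesis domW : forall v, v \notin D -> exists2 w, w \in W & e v w.
Hypothesis indcW : forall w w', w \in W -> w' \in W -> ~~ e (c w) (c w').

Lemma mem_block w : w \in D -> w \in B w.
Proof.
move=> wD; rewrite !inE; have [/cW|/(cD wD)->] := boolP (w \in W); last by rewrite eqxx.
by rewrite e_sym => ->; rewrite orbT.
Qed.

Lemma center_block w : c w \in B w.
Proof. by rewrite setU11. Qed.

Lemma block_inj w w' i : w \in D -> w' \in D -> i \in B w -> i \in B w' -> w = w'.
Proof.
move=> wD w'D iw iw'; apply/eqP/negPn/negP => /(disB wD w'D) dis.
by rewrite (disjointFr dis iw) in iw'.
Qed.

Lemma packing_maximal : maximal_independent e setT D.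
Proof.
split; [exact: subsetT|exact: indD|move=> i _ /domW[w wW iw]].
by exists w => //; apply: (subsetP WD).
Qed.

Lemma block_meets X w : maximal_independent e setT X -> B w :&: X != set0.
Proof.
move=> [_ _ maxX]; apply/set0Pn.
have [cX|/(maxX _ (in_setT _))[j jX cj]] := boolP (c w \in X).
  by exists (c w); rewrite inE center_block.
by exists j; rewrite !inE cj orbT.
Qed.

(** Picking one point of [X] in each of the disjoint blocks is an injection from [D] to [X]. *)
Lemma packing_leq X : maximal_independent e setT X -> (#|D| <= #|X|)%N.
Proof.
move=> maxX; pose g w := odflt w [pick x in B w :&: X].
have gP w : g w \in B w :&: X.
  rewrite /g; case: pickP => [x //|none]; have /set0Pn[x] := block_meets w maxX.
  by rewrite none.
rewrite -(card_in_imset (f := g)); last first.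
  move=> w w' wD w'D gE; apply: (@block_inj _ _ (g w)) => //.
    by have /setIP[] := gP w.
  by rewrite gE; have /setIP[] := gP w'.
by apply/subset_leq_card/subsetP => x /imsetP[w _ ->]; have /setIP[] := gP w.
Qed.

Section Socle.
Variable K : fieldType.
Local Notation S := {mpoly K[N]}.

Definition packing_forms : seq S := [seq linear_form K (B w) | w <- enum D].

Lemma packing_regular : regular (standard_ideal e setT) packing_forms.
Proof.
have -> : packing_forms = [seq linear_form K C | C <- [seq B w | w <- enum D]].
  by rewrite -map_comp.
apply: regular_forest => [|X C maxX /mapP[w _ ->]]; last exact: block_meets.
have : uniq (enum D) by exact: enum_uniq.
have : {subset enum D <= D} by move=> w; rewrite mem_enum.
elim: (enum D) => //= w s IH sD /andP[ws us]; rewrite IH //; last first.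
  by move=> x xs; apply: sD; rewrite inE xs orbT.
rewrite andbT; apply/allP => _ /mapP[x xs ->]; apply: disB.
- by apply: sD; rewrite mem_head.
- by apply: sD; rewrite inE xs orbT.
- by apply: contraNneq ws => ->.
Qed.

Let mW : 'X_{1..N} := [multinom (i \in W : nat) | i < N].
Let u : S := 'X_[mW].

(** The ideal generated by the squares of the variables; the squarefree monomial [u] is not in
    it. *)
Definition nonsquarefree_ideal (p : S) :=
  forall m, (forall i, (m i <= 1)%N) -> p@_m = 0.

Lemma nonsquarefree_ideal_ideal : is_ideal nonsquarefree_ideal.
Proof.
split=> [m _|a p q Jp Jq m sm]; first by rewrite mcoeff0.
rewrite mcoeffD Jq // addr0; apply/eqP/negPn/negP => /mcoeffM_neq0[m1 [m2 [mE _]]].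
rewrite Jp ?eqxx // => i; apply: leq_trans (sm i); rewrite mE mnmDE; exact: leq_addl.
Qed.

Lemma nonsquarefree_XX w : nonsquarefree_ideal ('X_w * 'X_w).
Proof.
move=> m sm; rewrite -mpolyXD mcoeffX; case: eqP => // mE.
by have := sm w; rewrite -mE mnmDE mnm1E eqxx.
Qed.

Lemma standard_ideal_X A m : ~~ standard e A m -> standard_ideal e A ('X_[m] : S).
Proof.
by move=> nsm m' sm'; rewrite mcoeffX; case: eqP => // mE; rewrite mE sm' in nsm.
Qed.

(** For [v] outside [D], a neighbour in [W] makes [x_v u] a multiple of an edge monomial. For [v] in
    [D], the form of its block trades [x_v] for the other variables of the block, all outside
    [D]. *)
Lemma packing_socle_kill v :
  adjoins (standard_ideal e setT) packing_forms ('X_v * u).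
Proof.
have iJ := adjoins_ideal packing_forms (@standard_ideal_ideal _ e K setT).
have out i : i \notin D -> adjoins (standard_ideal e setT) packing_forms ('X_i * u).
  move=> /domW[w wW iw]; apply: adjoins_sub; rewrite -mpolyXD.
  apply: standard_ideal_X; rewrite negb_and; apply/orP; right.
  apply/negP => /independentP/(_ i w); rewrite iw => /(_ _ _)/negP; apply => //.
    by rewrite inE mnmDE mnm1E eqxx.
  by rewrite inE mnmDE mnm1E mnmE wW addn1.
have [vD|/out//] := boolP (v \in D).
have -> : 'X_v * u = u * linear_form K (B v) - \sum_(i in B v | i != v) 'X_i * u.
  rewrite /linear_form (bigD1 v) ?mem_block //= mulrDr mulr_sumr.
  under eq_bigr do rewrite mulrC; by rewrite addrK mulrC.
apply: idealB => //.
  by apply: idealM => //; apply: adjoins_mem; [exact: standard_ideal_ideal|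
    apply: map_f; rewrite mem_enum].
apply: ideal_sum => // i /andP[iB iv]; apply: out; apply: contra iv => iD.
by apply/eqP; apply: block_inj iB => //; apply: mem_block.
Qed.

(** Modulo the squares of the variables, the substitution [lq] kills all edge monomials and forms
    but fixes the squarefree [u]. *)
Lemma packing_socle_nonzero : ~ adjoins (standard_ideal e setT) packing_forms u.
Proof.
pose lq : N.-tuple S := [tuple if i \in W then 'X_i else
  if [pick w in W | c w == i] is Some w then - 'X_w else 0 | i < N].
have lqX i : ('X_i \mPo lq) = if i \in W then 'X_i else
    if [pick w in W | c w == i] is Some w then - 'X_w else 0.
  by rewrite comp_mpolyXU -tnth_nth tnth_mktuple.
have lqW i : i \in W -> ('X_i \mPo lq) = 'X_i by move=> iW; rewrite lqX iW.
have lqc w : w \in W -> ('X_(c w) \mPo lq) = - 'X_w.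
  move=> wW; rewrite lqX; have wD := subsetP WD _ wW; case: ifP => [cwW|_].
    have := subsetP WD _ cwW; move=> cwD.
    have cww : c w = w by apply: block_inj (mem_block cwD) (center_block w).
    by have := cW wW; rewrite cww e_irr.
  case: pickP => [w' /andP[w'W /eqP cE]|/(_ w)]; last by rewrite wW eqxx.
  have w'D := subsetP WD _ w'W; suff -> : w' = w by [].
  apply: (@block_inj _ _ (c w)) => //; last exact: center_block.
  by rewrite -cE center_block.
have lq0 i : ('X_i \mPo lq) <> 0 -> i \in W \/ exists2 w, w \in W & i = c w.
  rewrite lqX; case: ifP => [|_]; first by left.
  by case: pickP => // w /andP[wW /eqP <-] _; right; exists w.
have i2 := nonsquarefree_ideal_ideal.
have iL : is_ideal (fun p => nonsquarefree_ideal (p \mPo lq)).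
  split=> [|a p q Jp Jq]; first by rewrite rmorph0; case: i2.
  by rewrite rmorphD rmorphM /=; apply: i2.2.
have edge0 i j : e i j -> nonsquarefree_ideal (('X_i \mPo lq) * ('X_j \mPo lq)).
  (* An edge between [w] and [c w'] puts [w] into the block of [w'], so [w = w'] and the edge
     monomial maps to minus the square of [x_w]. *)
  have half w w' : w \in W -> w' \in W -> e w (c w') ->
      nonsquarefree_ideal (- ('X_w * 'X_w')).
    move=> wW w'W ww'; have -> : w = w'.
      apply: (@block_inj _ _ w); rewrite ?(subsetP WD) ?mem_block ?(subsetP WD) //.
      by rewrite !inE e_sym ww' orbT.
    exact/(idealN i2)/nonsquarefree_XX.
  move=> ij; have [->|/eqP/lq0 hi] := eqVneq ('X_i \mPo lq) 0; first by rewrite mul0r; case: i2.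
  have [->|/eqP/lq0 hj] := eqVneq ('X_j \mPo lq) 0; first by rewrite mulr0; case: i2.
  case: hi ij => [iW|[w wW ->]]; case: hj => [jW|[w' w'W ->]] ij.
  - have /independentP/(_ i j) := indD; rewrite ij.
    by move=> /(_ (subsetP WD _ iW) (subsetP WD _ jW)).
  - by rewrite lqW // lqc // mulrN; apply: half.
  - by rewrite lqc // lqW // mulNr mulrC; apply: half => //; rewrite e_sym.
  - by have := indcW wW w'W; rewrite ij.
have lq_form w : w \in D -> (linear_form K (B w) \mPo lq) = 0.
  move=> wD; rewrite rmorph_sum /=.
  (* In a block only [w] and [c w] can survive, and only for [w] in [W]; their images [x_w] and
     [- x_w] cancel. *)
  have other i : i \in B w -> ('X_i \mPo lq) <> 0 -> w \in W /\ (i = w \/ i = c w).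
    move=> iB /lq0[iW|[w' w'W iE]].
      have iD := subsetP WD _ iW.
      by rewrite (block_inj wD iD iB (mem_block iD)); split=> //; left.
    have w'D := subsetP WD _ w'W; have ww' : w = w'.
      by apply: block_inj iB _ => //; rewrite iE center_block.
    by rewrite ww'; split=> //; right.
  have [wW|wW] := boolP (w \in W); last first.
    by rewrite big1 // => i /other h; apply/eqP/negPn/negP => /eqP/h[]; rewrite (negPf wW).
  have cww : c w != w by apply: contraTneq (cW wW) => ->; rewrite e_irr.
  rewrite (bigD1 w) ?mem_block //= (bigD1 (c w)) ?center_block //= lqW // lqc //.
  rewrite addrA subrr add0r big1 // => i /andP[/andP[iB iw] icw].
  by apply/eqP/negPn/negP => /eqP/(other _ iB)[_ [iE|iE]]; rewrite iE eqxx in iw icw.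
move=> Ju; have : nonsquarefree_ideal (u \mPo lq).
  apply: (adjoins_min iL) Ju => [p Ip|_ /mapP[w + ->]]; last first.
    by rewrite mem_enum => /lq_form->; case: i2.
  rewrite comp_mpolyEX big_seq; apply: ideal_sum => // m mp.
  have : ~~ standard e setT m by apply: contraTN mp => /Ip/eqP; rewrite mcoeff_eq0.
  rewrite /standard subsetT /= => /forall_inPn[i im /forall_inPn[j jm]].
  rewrite negbK => ij; rewrite -mul_mpolyC; apply: (idealM _ i2).
  have ij' : i != j by apply: contraTneq ij => ->; rewrite e_irr.
  rewrite !inE in im jm.
  have -> : m = (U_(i) + U_(j) + (m - (U_(i) + U_(j))))%MM.
    rewrite [RHS]addmC submK //; apply/mnm_lepP => k; rewrite mnmDE !mnm1E.
    have [<-|ik] := eqVneq i k; first by rewrite eq_sym (negPf ij') addn0 lt0n.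
    by case: eqP => // <-; rewrite lt0n.
  by rewrite !mpolyXD !rmorphM /= mulrC; apply: (idealM _ i2); exact: edge0.
have -> : u \mPo lq = u.
  rewrite /u comp_mpolyX [RHS]mpolyXE_id; apply: eq_bigr => i _.
  rewrite mnmE; have [iW|_] := boolP (i \in W); last by rewrite !expr0.
  by rewrite tnth_mktuple iW.
move=> /(_ mW); rewrite mcoeffX eqxx => /(_ _)/eqP; rewrite oner_eq0 => h.
by apply: notF; apply: h => i; rewrite mnmE leq_b1.
Qed.

Lemma packing_has_socle : has_socle (@maxideal K N)
  (adjoins (standard_ideal e setT) packing_forms).
Proof.
exists u; split=> [|_ [s sX ->]]; first exact: packing_socle_nonzero.
have iJ := adjoins_ideal packing_forms (@standard_ideal_ideal _ e K setT).
rewrite mulr_suml big_seq; apply: ideal_sum => // ag /sX[i ->].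
by rewrite -mulrA; apply: idealM => //; apply: packing_socle_kill.
Qed.

End Socle.
End Packing.
End ForestIdeals.

(** * The module K[V(G)]/I(G) *)

Lemma adjoinsP (R : comNzRingType) (J : R -> Prop) (fs : seq R) (p : R) :
  adjoins J fs p <-> exists c : nat -> R, J (p - \sum_(j < size fs) c j * fs`_j).
Proof.
elim: fs J => [|f fs IH] J /=.
  split=> [Jp|[c]]; last by rewrite big_ord0 subr0.
  by exists (fun=> 0); rewrite big_ord0 subr0.
rewrite IH; split=> [[c [a Jp]]|[c]].
  exists (fun j => if j is j'.+1 then c j' else a).
  by rewrite big_ord_recl /= opprD addrA addrAC.
rewrite big_ord_recl /= opprD addrA => Jp.
by exists (fun j => c j.+1), (c 0%N); rewrite addrAC.
Qed.

Lemma ideal_generated_ideal (R : comNzRingType) (A : R -> Prop) : is_ideal (ideal_generated A).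
Proof.
split=> [|a p q [s sA ->] [t tA ->]]; first by exists [::]; rewrite ?big_nil.
exists ([seq (a * cg.1, cg.2) | cg <- s] ++ t) => [cg|].
  by rewrite mem_cat => /orP[/mapP[cg' /sA ? ->]|/tA].
rewrite big_cat big_map /= mulr_sumr; congr (_ + _).
by apply: eq_bigr => cg _; rewrite mulrA.
Qed.

Section Restriction.
Variables (N : nat) (K : fieldType).
Local Notation S := {mpoly K[N]}.

Definition restrict (P : pred 'X_{1..N}) (p : S) : S :=
  \sum_(m <- msupp p | P m) p@_m *: 'X_[m].

Lemma mcoeff_restrict P p m : (restrict P p)@_m = if P m then p@_m else 0.
Proof.
rewrite /restrict raddf_sum /= big_mkcond /=.
rewrite (eq_bigr (fun m' => if m' == m then if P m then p@_m else 0 else 0)); last first.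
  move=> m' _; rewrite mcoeffZ mcoeffX; case: eqP => [->|_].
    by rewrite mulr1.
  by rewrite mulr0 if_same.
have [mp|mp] := boolP (m \in msupp p).
  by rewrite (bigD1_seq m) ?msupp_uniq //= eqxx big1 ?addr0 // => m' /negPf->.
rewrite (memN_msupp_eq0 mp) if_same big1 // => m' _; by rewrite if_same.
Qed.
End Restriction.

Section EdgeQuotient.
Variables (K : fieldType) (G : sgraph).
Local Notation N := #|G|.
Local Notation S := {mpoly K[N]}.
Local Notation Q := (edge_quotient K G).
Local Notation I := (@edge_ideal K G).

Definition edge_rel : rel 'I_N := fun i j => adj (enum_val i) (enum_val j).
Local Notation J0 := (standard_ideal edge_rel (K := K) setT).

(** A nonstandard monomial is divisible by the monomial of an edge inside its support. *)
Lemma edge_idealE (p : S) : p \in I <-> J0 p.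
Proof.
split=> [pI m /andP[_ /independentP im]|Jp].
  apply/eqP/negPn/negP; rewrite -mcoeff_msupp => mp.
  have [v [w [vw /mnm_lepP le_m]]] := edge_ideal_msupp pI mp.
  have := im (enum_rank v) (enum_rank w); rewrite /edge_rel !enum_rankK vw.
  rewrite !inE -!lt0n => h; apply: notF; apply: h.
    by apply: (leq_trans _ (le_m _)); rewrite mnmDE mnm1E eqxx.
  by apply: (leq_trans _ (le_m _)); rewrite mnmDE !mnm1E eqxx addn1.
rewrite [p]mpolyE big_seq; apply: rpred_sum => m mp.
have : ~~ standard edge_rel setT m by apply: contraTN mp => /Jp/eqP; rewrite mcoeff_eq0.
rewrite /standard subsetT /= => /forall_inPn[i im /forall_inPn[j jm]].
rewrite negbK => ij; rewrite !inE in im jm.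
have le_m : (edge_mnm (enum_val i) (enum_val j) <= m)%MM.
  apply/mnm_lepP => k; rewrite mnmDE !enum_valK !mnm1E.
  have ij' : i != j by apply: contraTneq ij => ->; rewrite /edge_rel adj_irr.
  have [<-|ik] := eqVneq i k; first by rewrite eq_sym (negPf ij') addn0 lt0n.
  by case: eqP => // <-; rewrite lt0n.
apply/asboolP; exists [:: (p@_m *: 'X_[m - edge_mnm (enum_val i) (enum_val j)],
  vvar K (enum_val i) * vvar K (enum_val j))].
  by move=> cg; rewrite inE => /eqP->; exists (enum_val i), (enum_val j).
by rewrite big_seq1 /= edge_mnmE -scalerAl -mpolyXD submK.
Qed.

Local Notation pi := (\pi_{ideal_quot I}).

Lemma pi_eq p q : pi p = pi q <-> J0 (p - q).
Proof.
rewrite -edge_idealE -quot_eq0 rmorphB subr_eq0; split=> [pq|/eqP pq]; last exact: pq.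
by apply/eqP; exact: pq.
Qed.

Lemma in_smul_pi fs p : in_smul (M := Q) fs (pi p) <-> adjoins J0 fs p.
Proof.
rewrite adjoinsP; split=> [[z pE]|[c Jc]].
  exists (fun j => repr (z j)); apply/pi_eq; rewrite pE rmorph_sum /=.
  by apply: eq_bigr => j _; rewrite mulrC -quot_scaleE reprK.
exists (fun j => pi (c j)); move/pi_eq: Jc => ->; rewrite rmorph_sum /=.
by apply: eq_bigr => j _; rewrite mulrC -quot_scaleE.
Qed.

Lemma maxideal_ideal : is_ideal (@maxideal K N).
Proof. exact: ideal_generated_ideal. Qed.

Lemma maxideal_X i : maxideal ('X_i : S).
Proof.
exists [:: (1, 'X_i)] => [ag|]; last by rewrite big_seq1 mul1r.
by rewrite inE => /eqP->; exists i.
Qed.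

(** Elements of [J0] and of the maximal ideal have zero constant term. *)
Lemma proper_adjoins fs : (forall f, f \in fs -> @maxideal K N f) -> ~ adjoins J0 fs 1.
Proof.
move=> mfs; have iP : is_ideal (fun p : S => p@_0%MM = 0).
  split=> [|a p q p0 q0]; first by rewrite mcoeff0.
  by rewrite mcoeffD q0 addr0 -[_@_0]/(mcoeff 0%MM _) rmorphM /= p0 mulr0.
move/(adjoins_min iP) => h; have : (1 : S)@_0%MM = 0; last first.
  by rewrite mcoeff1 eqxx => /eqP; rewrite oner_eq0.
apply: h => [p Jp|f /mfs[s sX ->]].
  apply: Jp; rewrite /standard mnm_supp0 sub0set.
  by apply/independentP => i j; rewrite inE.
rewrite big_seq; apply: (ideal_sum _ iP) => ag /sX[i ->].
apply: (@idealM _ (fun p : S => p@_0%MM = 0) ag.1 'X_i iP).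
by rewrite mcoeffX mnm1_eq0.
Qed.

Lemma regular_sequence_pi fs : regular_sequence Q fs -> regular J0 fs.
Proof.
move=> [rfs _]; apply/regular_nthP => i ifs p /in_smul_pi Jp.
by apply/in_smul_pi; apply: rfs => //; rewrite quot_scaleE.
Qed.

Lemma regular_in_max_pi fs : regular J0 fs -> (forall f, f \in fs -> @maxideal K N f) ->
  regular_sequence_in_max Q fs.
Proof.
move=> /regular_nthP rfs mfs; split=> //; split=> [i ifs x|]; last first.
  by exists (pi 1) => /in_smul_pi; apply: proper_adjoins.
rewrite -[x]reprK quot_scaleE => /in_smul_pi Jx; apply/in_smul_pi.
exact: rfs.
Qed.

(** A further term would kill the socle element, so the sequence is maximal; [regular_maximal_size]
    compares it with any other maximal one. *)
Lemma is_depth_of_socle fs : regular J0 fs -> (forall f, f \in fs -> @maxideal K N f) ->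
  has_socle (@maxideal K N) (adjoins J0 fs) -> is_depth Q (size fs).
Proof.
move=> rfs mfs sfs; have iJ := @standard_ideal_ideal _ edge_rel K setT.
split=> [|gs [[rgs mgs] maxgs]].
  exists fs; split=> [|g [rg mg]]; first exact: regular_in_max_pi.
  have [u [nu su]] := sfs; apply: nu.
  have /regular_rcons[_ ng] := regular_sequence_pi rg.
  by apply/ng/su/mg; rewrite mem_rcons mem_head.
apply: (regular_maximal_size (@mpoly_noetherian K N) maxideal_ideal iJ rfs) => //.
  exact: regular_sequence_pi.
move=> g mg rg; apply: (maxgs g); apply: regular_in_max_pi => // f.
by rewrite mem_rcons inE => /orP[/eqP->|/mgs].
Qed.

End EdgeQuotient.

(** * Stanley depth *)

Section StanleyDepth.
Variables (K : fieldType) (G : sgraph).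
Local Notation N := #|G|.
Local Notation S := {mpoly K[N]}.
Local Notation Q := (edge_quotient K G).
Local Notation I := (@edge_ideal K G).
Local Notation pi := (\pi_{ideal_quot I}).
Local Notation e := (@edge_rel G).
Local Notation J0 := (standard_ideal e (K := K) setT).
Implicit Types (m : 'X_{1..N}) (p q : S) (Z : {set 'I_N}).

Lemma in_subring_supp Z p : in_subring Z p <->
  forall m, m \in msupp p -> mnm_supp m \subset Z.
Proof.
split=> h m mp.
  by apply/subsetP => i; rewrite inE; apply: contraR => iZ; apply/eqP/(h m mp).
move=> i; apply: contraNeq => mi; apply: (subsetP (h m mp)); by rewrite inE.
Qed.

Lemma in_subring_sum (T : Type) (r : seq T) (P : pred T) (F : T -> S) Z :
  (forall i, P i -> in_subring Z (F i)) -> in_subring Z (\sum_(i <- r | P i) F i).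
Proof.
move=> FZ; elim/big_ind: _ => // [m|p q pZ qZ m]; first by rewrite msupp0.
by move/msuppD_le; rewrite mem_cat => /orP[/pZ|/qZ].
Qed.

Lemma in_subring_scaleX Z (a : K) m : mnm_supp m \subset Z -> in_subring Z (a *: 'X_[m]).
Proof. by move=> mZ; apply/in_subring_supp => m' /msuppZ_le; rewrite msuppX inE => /eqP->. Qed.

Lemma mcoeff_subring_cone Z p m0 m : in_subring Z p -> (p * 'X_[m0])@_m != 0 -> cone (m0, Z) m.
Proof.
move=> /in_subring_supp pZ /mcoeffM_neq0[m1 [m2 [-> m1p]]]; rewrite mcoeffX.
case: (_ =P m2) => [<- _|_]; last by rewrite eqxx.
by rewrite /cone /= lem_addl addmK pZ // mcoeff_msupp.
Qed.

Lemma homogeneous_monomial m : homogeneous (edge_grading K G) (pi 'X_[m]).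
Proof.
exists (mnm_deg m); exists 'X_[m] => // m'; by rewrite msuppX inE => /eqP->.
Qed.

(** * From a partition into cones to a Stanley decomposition *)

Section Decomposition.
Variable L : seq ('X_{1..N} * {set 'I_N}).
Hypothesis countL : forall m, count (fun c => cone c m) L = standard e setT m.
Let cn (j : 'I_(size L)) := tnth (in_tuple L) j.

Lemma sum_cone m : (\sum_(j < size L) cone (cn j) m)%N = standard e setT m.
Proof.
rewrite -countL -sum1_count [RHS]big_tnth [RHS]big_mkcond.
by apply: eq_bigr => j _; case: ifP.
Qed.

Lemma cone_standard j m : cone (cn j) m -> standard e setT m.
Proof. by move=> cm; rewrite -[standard _ _ _]lt0b -sum_cone (bigD1 j) //= cm. Qed.

Lemma cone_inj i j m : cone (cn i) m -> cone (cn j) m -> i = j.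
Proof.
move=> ci cj; apply/eqP/negPn/negP => ij.
have := sum_cone m; rewrite (cone_standard ci) (bigD1 i) //= (bigD1 j) 1?eq_sym //= ci cj.
by rewrite addnA.
Qed.

Lemma standard_cone m : standard e setT m -> exists j, cone (cn j) m.
Proof.
move=> sm; apply/existsP; apply: contraT; rewrite negb_exists => /forallP no.
by have := sum_cone m; rewrite sm big1 // => j _; rewrite (negPf (no j)).
Qed.

Let u (j : 'I_(size L)) : Q := pi 'X_[(cn j).1].
Let Z (j : 'I_(size L)) := (cn j).2.

Lemma cone_stanley_space j : is_stanley_space (edge_grading K G) (u j) (Z j).
Proof.
split=> [|p pZ pu]; first exact: homogeneous_monomial.
have {pu} Jp : J0 (p * 'X_[(cn j).1]).
  by apply/edge_idealE; rewrite -quot_eq0 -quot_scaleE; apply/eqP.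
apply/mpolyP => m; rewrite mcoeff0; apply/eqP/negPn/negP => pm.
have /negP := pm; apply; rewrite -(mcoeffMX p (cn j).1); apply/eqP/Jp/(@cone_standard j).
move: (pm); rewrite -(mcoeffMX p (cn j).1).
by move/(mcoeff_subring_cone pZ); rewrite /Z -surjective_pairing.
Qed.

Lemma restrict_cone_space j p : in_stanley_space (u j) (Z j) (pi (restrict (cone (cn j)) p)).
Proof.
exists (\sum_(m <- msupp p | cone (cn j) m) p@_m *: 'X_[m - (cn j).1]).
  by apply: in_subring_sum => m /andP[_ mZ]; apply: in_subring_scaleX.
rewrite quot_scaleE mulr_suml; congr (pi _); apply: eq_bigr => m /andP[le_m _].
by rewrite -scalerAl -mpolyXD submK.
Qed.

(** Restricting a representative to each cone gives the components. They are unique because each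
    standard monomial lies in exactly one cone, so only one summand can contain it. *)
Lemma cone_decomposition : stanley_decomposition (edge_grading K G) u Z.
Proof.
split=> [j|x]; first exact: cone_stanley_space.
rewrite -[x]reprK; set p := repr x; move: p => p {x}.
have sum_restrict m : standard e setT m ->
    p@_m = \sum_j (restrict (cone (cn j)) p)@_m.
  move=> /standard_cone[j cj]; rewrite (bigD1 j) //= mcoeff_restrict cj big1 ?addr0 // => i ij.
  rewrite mcoeff_restrict; case: ifP => // ci.
  by rewrite (cone_inj ci cj) eqxx in ij.
exists [ffun j => pi (restrict (cone (cn j)) p)]; split.
  split=> [j|]; first by rewrite ffunE; apply: restrict_cone_space.
  under eq_bigr do rewrite ffunE.
  rewrite -rmorph_sum; apply/pi_eq => m sm.
  by rewrite mcoeffB raddf_sum /= -sum_restrict // subrr.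
move=> w [wZ pE]; apply/ffunP => j; rewrite ffunE.
have /choice[q hq] : forall i, exists q, in_subring (Z i) q /\ w i = pi (q * 'X_[(cn i).1]).
  by move=> i; have [q qZ ->] := wZ i; exists q; rewrite quot_scaleE.
rewrite (hq j).2; apply/pi_eq => m sm; rewrite mcoeffB mcoeff_restrict.
have qcone i : (q i * 'X_[(cn i).1])@_m != 0 -> cone (cn i) m.
  by move/(mcoeff_subring_cone (hq i).1); rewrite /Z -surjective_pairing.
have pm : p@_m = \sum_i (q i * 'X_[(cn i).1])@_m.
  have : J0 (p - \sum_i q i * 'X_[(cn i).1]).
    apply/pi_eq; rewrite pE rmorph_sum; apply: eq_bigr => i _; exact: (hq i).2.
  by move=> /(_ m sm)/eqP; rewrite mcoeffB raddf_sum /= subr_eq0 => /eqP.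
case: ifP => cj; last first.
  apply/eqP; rewrite sub0r oppr_eq0; apply/negPn/negP => /qcone.
  by rewrite cj.
rewrite pm (bigD1 j) //= big1 ?addr0 ?subrr // => i ij.
apply/eqP/negPn/negP => /qcone ci; by rewrite (cone_inj ci cj) eqxx in ij.
Qed.

End Decomposition.

Lemma leq_bigminP (d r : nat) (F : 'I_r -> nat) : (d <= N)%N ->
  (forall j, (d <= F j)%N) -> (d <= \big[minn/N]_(j < r) F j)%N.
Proof. by move=> dN dF; elim/big_ind: _ => // a b; rewrite leq_min => -> ->. Qed.

Lemma bigmin_leq (r : nat) (F : 'I_r -> nat) j : (\big[minn/N]_(i < r) F i <= F j)%N.
Proof.
have := mem_index_enum j; elim: (index_enum _) => // i s IH.
rewrite inE big_cons => /orP[/eqP->|/IH h].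
  exact: geq_minl.
exact: leq_trans (geq_minr _ _) h.
Qed.

(* A high power of the squarefree monomial of a maximal independent set [D]
   spans its graded component, so it lies in a single Stanley space [u K[Z]],
   and its exponent forces [Z = D]. *)
Lemma stanley_decomposition_facet (D : {set 'I_N}) (r : nat) (u : 'I_r -> Q)
    (Z : 'I_r -> {set 'I_N}) :
  maximal_independent e setT D -> stanley_decomposition (edge_grading K G) u Z ->
  exists j, Z j = D.
Proof.
move=> [_ indD maxD] [uZ dec].
have /choice[a ha] : forall j, exists ap : {ffun 'I_N -> int} * S,
    deg_supported ap.1 ap.2 /\ u j = pi ap.2.
  by move=> j; have [[a [p ap ->]] _] := uZ j; exists (a, p).
(* [t] exceeds every coordinate of the degrees of the generators [u j], so the factor [m2] coming
   from a generator cannot exhaust the exponent [t] on [D]. *)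
pose t := (\sum_(j < r) \sum_(i < N) `|(a j).1 i|).+1%N.
pose M : 'X_{1..N} := [multinom (if i \in D then t else 0%N) | i < N].
have suppM : mnm_supp M = D by apply/setP => i; rewrite inE mnmE; case: ifP.
have sM : standard e setT M by rewrite /standard suppM subsetT.
have [w [[wZ wE] _]] := dec (pi 'X_[M]).
have /choice[q hq] : forall j, exists q, in_subring (Z j) q /\ w j = pi (q * (a j).2).
  by move=> j; have [q qZ ->] := wZ j; exists q; rewrite (ha j).2 quot_scaleE.
have [j jM] : exists j, (q j * (a j).2)@_M != 0.
  apply: contrapT => no; have : J0 ('X_[M] - \sum_j q j * (a j).2).
    apply/pi_eq; rewrite wE rmorph_sum; apply: eq_bigr => i _; exact: (hq i).2.
  move=> /(_ M sM)/eqP; rewrite mcoeffB mcoeffX eqxx raddf_sum /= big1 ?subr0 ?oner_eq0 // => i _.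
  by apply/eqP/negPn/negP => iM; apply: no; exists i.
have [m1 [m2 [ME m1q m2a]]] := mcoeffM_neq0 jM.
have m1Z : mnm_supp m1 \subset Z j.
  by have /in_subring_supp := (hq j).1; apply; rewrite mcoeff_msupp.
have m2deg := (ha j).1 m2; rewrite mcoeff_msupp in m2deg; have {m2deg} m2deg := m2deg m2a.
have aE : (a j).2 = (a j).2@_m2 *: 'X_[m2].
  apply/mpolyP => m; rewrite mcoeffZ mcoeffX; case: eqP => [->|m2m]; first by rewrite mulr1.
  rewrite mulr0; apply: (deg_supported_coef (ha j).1); apply/eqP => mdeg; apply: m2m.
  by apply: (@mnm_deg_inj N); rewrite m2deg.
have m2t i : (m2 i < t)%N.
  rewrite ltnS; have -> : m2 i = `|(a j).1 i|%N by rewrite -m2deg ffunE.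
  by rewrite (bigD1 j) //= (bigD1 i) //= -addnA leq_addr.
exists j; apply/eqP; rewrite eqEsubset; apply/andP; split; last first.
  apply: subset_trans m1Z; apply/subsetP => i iD; rewrite inE; apply/eqP => m1i.
  have /mnmP/(_ i) := ME; rewrite mnmDE mnmE iD m1i add0n => tE.
  by have := m2t i; rewrite -tE ltnn.
apply/subsetP => i iZ; apply: contraT => iD.
(* A vertex [i] of [Z j] outside [D] has a neighbour [k] in [D], so [x_i X^m1] would kill the
   generator, against freeness. *)
have [k kD ik] := maxD i (in_setT _) iD.
have : 'X_[U_(i) + m1] = 0 :> S.
  apply: (uZ j).2.
    move=> m; rewrite msuppX inE => /eqP-> l lZ; rewrite mnmDE mnm1E.
    have -> : (i == l) = false by apply: contraNF lZ => /eqP <-.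
    rewrite add0n; apply/eqP; move: lZ; apply: contraNT => m1l.
    by apply: (subsetP m1Z); rewrite inE.
  rewrite (ha j).2 quot_scaleE; apply/eqP; rewrite quot_eq0; apply/edge_idealE.
  rewrite aE -scalerAr -mpolyXD -addmA -ME => m sm; rewrite mcoeffZ mcoeffX.
  case: eqP => [mE|]; last by rewrite mulr0.
  move: sm; rewrite -mE /standard => /andP[_ /independentP/(_ i k)].
  rewrite mnm_suppD mnm_suppU suppM !inE eqxx kD orbT ik.
  by move=> /(_ isT isT).
by move/eqP; rewrite -msupp_eq0 msuppX.
Qed.

Lemma is_sdepth_of_partition (D : {set 'I_N}) (L : seq ('X_{1..N} * {set 'I_N})) :
  maximal_independent e setT D ->
  (forall m, count (fun c => cone c m) L = standard e setT m) ->
  (forall c, c \in L -> (#|D| <= #|c.2|)%N) ->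
  is_sdepth (edge_grading K G) #|D|.
Proof.
move=> maxD countL leD.
have upper r (u : 'I_r -> Q) (Z : 'I_r -> {set 'I_N}) :
    stanley_decomposition (edge_grading K G) u Z ->
    (sdepth_decomposition Z <= #|D|)%N.
  by move=> /(stanley_decomposition_facet maxD)[j <-]; apply: bigmin_leq.
split=> //; have dec := cone_decomposition countL.
eexists _, _, _; split; first exact: dec.
apply/eqP; rewrite eqn_leq (upper _ _ _ dec) /=; apply: leq_bigminP => [|j].
  (* The default value [N] of the minimum is at least [#|D|] as well. *)
  by rewrite -[X in (_ <= X)%N]card_ord max_card.
by apply: leD; apply: mem_tnth.
Qed.

End StanleyDepth.

(** * The perfect semiregular tree *)

Section ForestDepth.
Variables (K : fieldType) (G : sgraph).
Local Notation e := (@edge_rel G).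
Variables (rank : G -> nat) (D W : {set G}) (c : G -> G).
Hypothesis rank_adj : forall v w : G, adj v w -> rank v != rank w.
Hypothesis rank_parent : forall v w w' : G, adj v w -> adj v w' ->
  (rank w < rank v)%N -> (rank w' < rank v)%N -> w = w'.
Hypotheses (WD : W \subset D) (indD : forall v w, v \in D -> w \in D -> ~~ adj v w).
Hypothesis cW : forall w, w \in W -> adj w (c w).
Hypothesis cD : forall w, w \in D -> w \notin W -> c w = w.
Hypothesis disB : forall w w' v, w \in D -> w' \in D ->
  (v == c w) || adj (c w) v -> (v == c w') || adj (c w') v -> w = w'.
Hypothesis domW : forall v, v \notin D -> exists2 w, w \in W & adj v w.
Hypothesis indcW : forall w w', w \in W -> w' \in W -> ~~ adj (c w) (c w').

(** The packing on the vertices of [G] is transported along [enum_val] to the indices of the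
    variables, where the bounds above apply. *)
Theorem forest_depth_sdepth :
  is_depth (edge_quotient K G) #|D| /\ is_sdepth (edge_grading K G) #|D|.
Proof.
pose ev (i : 'I_#|G|) : G := enum_val i.
pose rk i := rank (ev i); pose D' := ev @^-1: D; pose W' := ev @^-1: W.
pose c' i := enum_rank (c (ev i)).
have e_sym : ssrbool.symmetric e by move=> i j; apply: adj_sym.
have e_irr : irreflexive e by move=> i; apply: adj_irr.
have evc i : ev (c' i) = c (ev i) by apply: enum_rankK.
have rk_adj i j : e i j -> rk i != rk j by apply: rank_adj.
have rk_parent i j j' : e i j -> e i j' -> (rk j < rk i)%N -> (rk j' < rk i)%N -> j = j'.
  by move=> ij ij' ji j'i; apply/enum_val_inj/(rank_parent ij ij').
have WD' : W' \subset D' by apply: preimsetS.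
have indD' : independent e D'.
  by apply/independentP => i j; rewrite !inE; apply: indD.
have cW' w : w \in W' -> e w (c' w).
  by rewrite inE => /cW; rewrite -evc.
have cD' w : w \in D' -> w \notin W' -> c' w = w.
  by rewrite !inE => wD /(cD wD) cw; apply: enum_val_inj; exact: etrans (evc w) cw.
have mem_blockE w v : (v \in c' w |: neighbours e (c' w)) =
    (ev v == c (ev w)) || adj (c (ev w)) (ev v).
  by rewrite !inE /edge_rel -/(ev _) -/(ev _) evc -evc (inj_eq enum_val_inj).
have disB' w w' : w \in D' -> w' \in D' -> w != w' ->
    [disjoint c' w |: neighbours e (c' w) & c' w' |: neighbours e (c' w')].
  rewrite !inE => wD w'D; apply: contraNT => /pred0Pn[v /andP[]] /=.
  rewrite !mem_blockE => vw vw'; apply/eqP/enum_val_inj; exact: disB vw vw'.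
have domW' v : v \notin D' -> exists2 w, w \in W' & e v w.
  rewrite inE => /domW[w wW vw]; exists (enum_rank w).
    by rewrite inE /ev enum_rankK.
  by rewrite /edge_rel enum_rankK.
have indcW' w w' : w \in W' -> w' \in W' -> ~~ e (c' w) (c' w').
  by rewrite !inE => wW w'W; have := indcW wW w'W; rewrite -!evc.
have cardD : #|D'| = #|D|.
  rewrite on_card_preimset //; exists enum_rank => v _; [exact: enum_valK|exact: enum_rankK].
split.
  have -> : #|D| = size (packing_forms e D' c' K) by rewrite size_map -cardE.
  apply: is_depth_of_socle.
  - exact: (packing_regular e_sym e_irr rk_adj rk_parent).
  - move=> f /mapP[w _ ->]; apply: (ideal_sum _ (@maxideal_ideal K G)) => i _.
    exact: maxideal_X.
  - exact: (packing_has_socle e_sym e_irr WD').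
have [L [Lmax Lcount]] := cone_partition e_sym e_irr rk_adj rk_parent setT.
rewrite -cardD; apply: (is_sdepth_of_partition K _ Lcount) => [|x /Lmax].
  exact: (packing_maximal WD').
exact: (packing_leq disB').
Qed.
End ForestDepth.

(** * The packing in the perfect semiregular tree *)

Section Tree.
Variables n k : nat.
Hypothesis hn : (3 <= n)%N.
Local Notation T := (tree_vertex n k).
Implicit Types (v w : T) (s : seq 'I_n).

Definition level v := size (tree_word v).

Definition tree_valid s := (size s <= k)%N && all (fun i : 'I_n => i < n.-1)%N (behead s).

Lemma tree_word_inj : injective (@tree_word n k).
Proof. by move=> v w /val_inj/val_inj. Qed.

Lemma tree_word_valid v : tree_valid (tree_word v).
Proof. by rewrite /tree_valid /tree_word size_bseq (valP v). Qed.

Lemma tree_wordP s : tree_valid s -> exists v, tree_word v = s.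
Proof. by move=> /andP[sk sn]; exists (exist _ (Bseq sk) sn). Qed.

Lemma level_leq v : (level v <= k)%N.
Proof. by have /andP[] := tree_word_valid v. Qed.

Lemma tree_parentP v w : tree_adj v w -> (level w < level v)%N ->
  exists i, tree_word v = rcons (tree_word w) i.
Proof.
case/orP => /existsP[i /eqP E] lt; last by exists i.
by move: lt; rewrite /level E size_rcons ltnNge leqnSn.
Qed.

Lemma tree_adj_level v w : tree_adj v w -> level v = (level w).+1 \/ level w = (level v).+1.
Proof.
by case/orP => /existsP[i /eqP E]; rewrite /level E size_rcons; [right|left].
Qed.

Lemma rcons_valid s i : tree_valid (rcons s i) -> tree_valid s.
Proof.
rewrite /tree_valid size_rcons; case: s => [|x s] //= /andP[/ltnW-> /=].
by rewrite all_rcons => /andP[_ ->].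
Qed.

Let i0 : 'I_n := Ordinal (ltnW (ltnW hn)).

Lemma first_child_exists v : (level v < k)%N ->
  exists w, tree_word w = rcons (tree_word v) i0.
Proof.
move=> vk; apply: tree_wordP; have := tree_word_valid v.
rewrite /tree_valid size_rcons -/(level v) vk => /andP[_]; case: (tree_word v) => //= x s sn.
by rewrite all_rcons sn /=; case: n hn => [|[|m]].
Qed.

(** The levels congruent to [k - 1] modulo 3, written without subtraction. *)
Definition tree_W : {set T} := [set v | ((level v).+1 %% 3 == k %% 3)%N].
Definition tree_D : {set T} := [set v | (v \in tree_W) || (3 %| k)%N && (level v == 0%N)].
Definition tree_center v : T := if v \in tree_W then
  odflt v [pick w | tree_word w == rcons (tree_word v) i0] else v.

Lemma tree_W_level w : w \in tree_W -> (level w < k)%N.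
Proof. by rewrite inE; have := level_leq w; lia. Qed.

Lemma tree_center_word w : w \in tree_W ->
  tree_word (tree_center w) = rcons (tree_word w) i0.
Proof.
move=> wW; rewrite /tree_center wW; case: pickP => [v /eqP //|no].
by have [v vE] := first_child_exists (tree_W_level wW); have := no v; rewrite vE eqxx.
Qed.

(** [w] can be read off from any [v] in its block, so blocks are disjoint. For [w] in [tree_W] the
    block has levels [level w + j] with [j = 0, 1, 2]; as [level w] is [k - 1] and [2 k] is [- k]
    modulo 3, [j] is the remainder that is subtracted. *)
Lemma tree_block_word w v : w \in tree_D ->
  (v == tree_center w) || tree_adj (tree_center w) v ->
  tree_word w = take (level v - (level v + 1 + 2 * k) %% 3)%N (tree_word v).
Proof.
rewrite inE; have [wW _|wW /= /andP[k3 /nilP w0]] := boolP (w \in tree_W).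
  have cw := tree_center_word wW; move: wW; rewrite inE => /eqP wW.
  have take_rcons (s : seq 'I_n) i j : j = size s -> take j (rcons s i) = s.
    by move=> ->; rewrite -cats1 take_size_cat.
  case/or3P => [/eqP->|/existsP[i /eqP E]|/existsP[i /eqP E]]; rewrite /level in wW *.
  - by rewrite cw size_rcons take_rcons //; lia.
  - rewrite E cw !size_rcons.
    rewrite -cats1 take_cat size_rcons ifT ?take_rcons //; lia.
  - move: E; rewrite cw => /rcons_inj[wv _]; rewrite wv in wW *.
    by rewrite take_oversize // /level; lia.
have -> : tree_center w = w by rewrite /tree_center (negPf wW).
(* In the block of the root, levels 0 and 1 give remainders 1 and 2, and truncated subtraction
   returns 0. *)
rewrite w0; case/or3P => [/eqP->|/existsP[i /eqP E]|/existsP[i /eqP E]].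
- by rewrite /level w0.
- rewrite /level E w0 /=; suff -> : (1 - (1 + 1 + 2 * k) %% 3 = 0)%N by [].
  by lia.
- by move: E; rewrite w0 => /(congr1 size); rewrite size_rcons.
Qed.

Lemma tree_level_adj v w : tree_adj v w -> level v != level w.
Proof. by case/tree_adj_level => ->; rewrite neq_ltn ltnSn ?orbT. Qed.

Lemma tree_parent_inj v w w' : tree_adj v w -> tree_adj v w' ->
  (level w < level v)%N -> (level w' < level v)%N -> w = w'.
Proof.
move=> vw vw' /(tree_parentP vw)[i E] /(tree_parentP vw')[i'].
by rewrite E => /rcons_inj[/tree_word_inj].
Qed.

Lemma tree_D_independent v w : v \in tree_D -> w \in tree_D -> ~~ tree_adj v w.
Proof. by rewrite !inE => vD wD; apply/negP => /tree_adj_level; lia. Qed.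

Lemma tree_center_adj w : w \in tree_W -> tree_adj w (tree_center w).
Proof.
by move=> wW; apply/orP; left; apply/existsP; exists i0; rewrite tree_center_word.
Qed.

Lemma tree_center_root w : w \in tree_D -> w \notin tree_W -> tree_center w = w.
Proof. by move=> _ wW; rewrite /tree_center (negPf wW). Qed.

Lemma tree_block_disjoint w w' v : w \in tree_D -> w' \in tree_D ->
  (v == tree_center w) || tree_adj (tree_center w) v ->
  (v == tree_center w') || tree_adj (tree_center w') v -> w = w'.
Proof.
move=> wD w'D vw vw'; apply: tree_word_inj.
by rewrite (tree_block_word wD vw) (tree_block_word w'D vw').
Qed.

(** At a level congruent to [k] the parent is in [tree_W]; the root is excluded, being in [tree_D]
    in that case. A level congruent to [k - 2] is below [k], so a first child exists and is in
    [tree_W]. *)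
Lemma tree_W_dominating v : v \notin tree_D -> exists2 w, w \in tree_W & tree_adj v w.
Proof.
rewrite !inE negb_or => /andP[vW vR]; have vk := level_leq v.
have [vk3|vk3] := eqVneq (level v %% 3)%N (k %% 3)%N.
  have v0 : level v != 0%N by lia.
  move: vk3 v0 (tree_word_valid v); rewrite /level.
  case E : (tree_word v) / (lastP (tree_word v)) => [//|s i].
  rewrite size_rcons => vk3 _ /rcons_valid.
  move=> /tree_wordP[w wE]; exists w; first by rewrite inE /level wE; lia.
  by apply/orP; right; apply/existsP; exists i; rewrite wE E.
have [|w wE] := @first_child_exists v; first by lia.
exists w; first by rewrite inE /level wE size_rcons -/(level v); lia.
by apply/orP; left; apply/existsP; exists i0; rewrite wE.
Qed.

Lemma tree_centers_independent w w' : w \in tree_W -> w' \in tree_W ->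
  ~~ tree_adj (tree_center w) (tree_center w').
Proof.
move=> wW w'W; have := tree_center_word wW; have := tree_center_word w'W.
move: wW w'W; rewrite !inE => wW w'W E E'; apply/negP => /tree_adj_level.
by rewrite /level E E' !size_rcons -/(level w) -/(level w'); lia.
Qed.

Lemma perfect_tree_depth_sdepth (K : fieldType) :
  is_depth (edge_quotient K (perfect_tree n k)) #|tree_D| /\
  is_sdepth (edge_grading K (perfect_tree n k)) #|tree_D|.
Proof.
apply: (@forest_depth_sdepth K (perfect_tree n k) level tree_D tree_W tree_center).
- exact: tree_level_adj.
- exact: tree_parent_inj.
- by apply/subsetP => v vW; rewrite inE vW.
- exact: tree_D_independent.
- exact: tree_center_adj.
- exact: tree_center_root.
- exact: tree_block_disjoint.
- exact: tree_W_dominating.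
- exact: tree_centers_independent.
Qed.
End Tree.

(** * Counting [tree_D] level by level *)

Definition level_card (n l : nat) : nat := if l is l'.+1 then (n * n.-1 ^ l')%N else 1%N.

Section Count.
Variables n k : nat.
Hypothesis hn : (3 <= n)%N.
Local Notation T := (tree_vertex n k).

(** A vertex of level [l + 1] is a first letter among [n] followed by [l] letters among [n - 1]. *)
Lemma card_level l : (l <= k)%N -> #|[set v : T | level v == l]| = level_card n l.
Proof.
case: l => [_|l lk].
  have [r rE] := @tree_wordP n k [::] isT.
  apply/eqP/cards1P; exists r; apply/setP => v; rewrite !inE.
  apply/nilP/eqP => [vE|->//]; by apply: tree_word_inj; rewrite vE.
have n1 : (0 < n.-1)%N by lia.
have le_n : (n.-1 <= n)%N by exact: leq_pred.
pose wd := widen_ord le_n.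
have /choice[f fE] (xt : 'I_n * l.-tuple 'I_n.-1) :
    exists v : T, tree_word v = xt.1 :: map wd xt.2.
  apply: tree_wordP; rewrite /tree_valid /= size_map size_tuple lk /=.
  by apply/allP => _ /mapP[i _ ->] /=.
have finj : injective f.
  move=> [x t] [x' t'] /(congr1 (@tree_word n k)); rewrite !fE /= => -[-> tt'].
  congr (_, _); apply/val_inj; apply: inj_map tt' => i j /(congr1 val) /= ij.
  exact: val_inj.
have -> : [set v : T | level v == l.+1] = f @: setT.
  apply/setP => v; rewrite inE; apply/eqP/imsetP => [vl|[xt _ ->]]; last first.
    by rewrite /level fE /= size_map size_tuple.
  have /andP[_] := tree_word_valid v; move: vl; rewrite /level.
  case vE : (tree_word v) => [//|x s] /= [sl] /allP sn.
  pose g (i : 'I_n) : 'I_n.-1 := insubd (Ordinal n1) (val i).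
  have st : size (map g s) == l by rewrite size_map sl.
  exists (x, Tuple st) => //; apply: tree_word_inj; rewrite fE vE /=; congr (_ :: _).
  rewrite -map_comp -[LHS]map_id; apply/eq_in_map => i /sn i_n; apply/val_inj => /=.
  by rewrite insubdK.
by rewrite card_imset // cardsT card_prod card_tuple !card_ord.
Qed.

Lemma card_tree_W : #|tree_W n k| =
  (\sum_(l < k.+1 | l.+1 %% 3 == k %% 3) level_card n l)%N.
Proof.
have lt_level (v : T) : (level v < k.+1)%N by rewrite ltnS level_leq.
rewrite -sum1_card (partition_big (fun v => Ordinal (lt_level v))
  (fun l : 'I_k.+1 => l.+1 %% 3 == k %% 3)%N) /=; last by move=> v; rewrite inE.
apply: eq_bigr => l lk; rewrite -(@card_level l) -1?ltnS // -sum1_card.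
apply: eq_bigl => v; rewrite !inE -val_eqE /=.
by case: (level v =P l) => [->|]; rewrite ?andbF // lk.
Qed.

(** If 3 divides [k], [tree_W] occupies levels congruent to 2, so the root is one extra vertex. *)
Lemma card_tree_D : #|tree_D n k| =
  (\sum_(l < k.+1 | l.+1 %% 3 == k %% 3) level_card n l + (3 %| k))%N.
Proof.
rewrite -card_tree_W; have [k3|k3] := boolP (3 %| k)%N; last first.
  by rewrite addn0; apply: eq_card => v; rewrite inE (negPf k3) orbF.
have -> : tree_D n k = tree_W n k :|: [set v : T | level v == 0%N].
  by apply/setP => v; rewrite !inE k3.
rewrite cardsU card_level // disjoint_setI0 ?cards0 ?subn0 //.
apply/pred0P => v /=; rewrite !inE; apply/negP => /andP[]; lia.
Qed.
End Count.

(** Of the three new levels only [k + 2] satisfies the congruence. *)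
Lemma sum_level_card3 n k :
  (\sum_(l < k.+4 | l.+1 %% 3 == k.+3 %% 3) level_card n l =
   \sum_(l < k.+1 | l.+1 %% 3 == k %% 3) level_card n l + n * n.-1 ^ k.+1)%N.
Proof.
rewrite big_mkcond 3!big_ord_recr /= -big_mkcond /=.
rewrite (_ : (k.+4 %% 3 == k.+3 %% 3)%N = false); last by lia.
rewrite (_ : (k.+3 %% 3 == k.+3 %% 3)%N = true) ?eqxx //.
rewrite (_ : (k.+2 %% 3 == k.+3 %% 3)%N = false); last by lia.
by rewrite !addn0; congr (_ + _)%N; apply: eq_bigl => l; rewrite -[k.+3]addn3 modnDr.
Qed.

(** * Agreement with the closed formula *)

Section ClosedForm.
Variable n : nat.
Hypothesis hn : (3 <= n)%N.
Let q : rat := n%:R.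

Definition closed_form (k : nat) : rat :=
  if (k %% 3 == 0)%N then
    (q * (q - 1) ^+ k.+1 + q ^+ 3 - 4 * q ^+ 2 + 4 * q - 2) / ((q - 1) ^+ 3 - 1)
  else if (k %% 3 == 1)%N then
    (q * (q - 1) ^+ k.+1 - q ^+ 2 + 2 * q - 2) / ((q - 1) ^+ 3 - 1)
  else (q * (q - 1) ^+ k.+1 - q) / ((q - 1) ^+ 3 - 1).

Let den_neq0 : (q - 1) ^+ 3 - 1 != 0.
Proof.
have q3 : 3 <= q by rewrite /q (ler_nat _ 3).
have -> : (q - 1) ^+ 3 - 1 = (q - 2) * (q ^+ 2 - q + 1) by ring.
by rewrite mulf_neq0 //; apply/eqP; nra.
Qed.

(** The remaining terms of the numerator depend only on [k] modulo 3, so the difference is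
    [q (q - 1)^(k+1) ((q - 1)^3 - 1)] over the denominator. *)
Lemma closed_form3 k : closed_form k.+3 = closed_form k + q * (q - 1) ^+ k.+1.
Proof.
have := den_neq0; rewrite /closed_form -[k.+3]addn3 modnDr => d0.
have -> : (q - 1) ^+ (k + 3).+1 = (q - 1) ^+ k.+1 * (q - 1) ^+ 3 by rewrite -exprD addSn.
by case: ifP => _; [|case: ifP => _]; field.
Qed.

Lemma card_tree_closed_form k :
  (\sum_(l < k.+1 | l.+1 %% 3 == k %% 3) level_card n l + (3 %| k))%N%:R = closed_form k.
Proof.
have d0 := den_neq0; have n1 : n.-1%:R = q - 1 :> rat.
  by rewrite -subn1 natrB //; lia.
(* Induction in steps of 3 from the base cases [k = 0, 1, 2]. *)
elim/ltn_ind: k => -[|[|[|k]]] IH.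
- rewrite big_mkcond !big_ord_recr big_ord0 /= /closed_form /=; field.
  by rewrite d0.
- rewrite big_mkcond !big_ord_recr big_ord0 /= /closed_form /=; field.
  by rewrite d0.
- rewrite big_mkcond !big_ord_recr big_ord0 /= /closed_form /=.
  by rewrite expn0 muln1 add0n !addn0 -/q; field.
rewrite sum_level_card3 closed_form3 -IH; last by lia.
by rewrite -[k.+3]addn3 dvdn_addl // !natrD natrM natrX n1 addrAC.
Qed.
End ClosedForm.

Theorem theorem2p6 (K : fieldType) (n k : nat) (hn : (3 <= n)%N) (hk : (1 <= k)%N) :
  let T := perfect_tree n k in
  let q : rat := n%:R in
  exists d : nat,
    [/\ is_depth (edge_quotient K T) d,
        is_sdepth (edge_grading K T) d
      & d%:R = (if (k %% 3 == 0)%N then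
                  (q * (q - 1) ^+ k.+1 + q ^+ 3 - 4 * q ^+ 2 + 4 * q - 2)
                    / ((q - 1) ^+ 3 - 1)
                else if (k %% 3 == 1)%N then
                  (q * (q - 1) ^+ k.+1 - q ^+ 2 + 2 * q - 2)
                    / ((q - 1) ^+ 3 - 1)
                else
                  (q * (q - 1) ^+ k.+1 - q) / ((q - 1) ^+ 3 - 1)) :> rat].
Proof.
have [dep sdep] := perfect_tree_depth_sdepth k hn K.
exists #|tree_D n k|; split=> //.
by rewrite card_tree_D // card_tree_closed_form.
Qed.
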